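(* Work in the setting described in the context. Let $\varphi$ be smooth on $Q_T^{\mathrm{cl}}=[0,T]\times\overline O$ and let $0<\Delta t\le1$. Then, uniformly in $a\in A$ and in the interior nodes ($x_i\in G_h\cap O$, $0\le n<N_{\Delta t}$), $$\widehat S^a_{n,i}[\varphi]-\varphi(t_n,x_i)=\tau_{n,i}(a)F^a[\varphi](t_n,x_i)+R^a_{n,i}[\varphi],$$ where $$|R^a_{n,i}[\varphi]|\le C\tau_{n,i}(a)\Bigl[\sqrt{\Delta t}\bigl(\|D\varphi\|_\infty+\|D^2\varphi\|_\infty+\|D^3\varphi\|_\infty+\|D\partial_t\varphi\|_\infty\bigr)+\Delta t\bigl(\|\varphi\|_\infty+\|\partial_t\varphi\|_\infty+\|D^2\varphi\|_\infty+\|\partial_{tt}\varphi\|_\infty\bigr)+\frac{h^2}{\Delta t}\bigl(\|D\varphi\|_\infty+\|D^2\varphi\|_\infty\bigr)\Bigr],$$ with sup norms over $Q_T^{\mathrm{cl}}$ and a constant $C$ independent of $a,n,i,h,\Delta t$ and $\varphi$. Consequently, $$\inf_{a\in A}\frac{\widehat S^a_{n,i}[\varphi]-\varphi(t_n,x_i)}{\tau_{n,i}(a)}=\inf_{a\in A}F^a[\varphi](t_n,x_i)+O_\varphi\Bigl(\sqrt{\Delta t}+\frac{h^2}{\Delta t}\Bigr),$$ where the constant in $O_\varphi$ depends on $\varphi$ but not on $n,i,h,\Delta t$.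
   Context: **Data.** $N,p\ge1$ are integers, $O\subset\mathbb R^N$ is a bounded domain, $T>0$. $|\cdot|$ is the absolute value, Euclidean norm or Frobenius norm. $(A,d_A)$ is a nonempty compact metric space; $\sigma(t,x,a)\in\mathbb R^{N\times p}$, $\mu(t,x,a)\in\mathbb R^N$, $r(t,x,a),f(t,x,a)\in\mathbb R$ are defined on $[0,T]\times\overline O\times A$. Write $g^a(t,x)=g(t,x,a)$, $A^a=\sigma^a(\sigma^a)^\top$, and $$F^a[\varphi]=\partial_t\varphi+\tfrac12\operatorname{Tr}(A^aD^2\varphi)+\mu^a\cdot D\varphi-r^a\varphi+f^a .$$ Assumption: there is $K_0>0$ with $\sup_a(\|\sigma^a\|_\infty+\|\mu^a\|_\infty+\|r^a\|_\infty+\|f^a\|_\infty)\le K_0$; for each $g\in\{\sigma,\mu,r,f\}$, $|g(t,x,a)-g(s,y,a)|\le K_0(|x-y|+|t-s|^{1/2})$ for all $(t,x),(s,y)\in[0,T]\times\overline O$, $a\in A$; for each fixed $(t,x)$ the coefficients are continuous in $a$. Also $r\ge0$. (Terminal and boundary data play no role in this statement.) **Cubature.** Fixed $M\ge1$, $\eta_j\in\mathbb R^p\setminus\{0\}$, $\rho_j>0$ ($1\le j\le M$) with $\sum_j\rho_j=1$, $\sum_j\rho_j\eta_j\eta_j^\top=I_p$, independent of mesh and control. **Mesh.** $O_h$ is a polyhedral approximation of $O$, $\mathcal T_h$ a simplicial triangulation of $O_h$ with vertex set $G_h=\{x_i:1\le i\le N_h\}$, $h=\max_{E\in\mathcal T_h}\operatorname{diam}E$,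 $\psi_i$ the $P_1$ nodal basis; $N_{\Delta t}\in\mathbb N$, $\Delta t=T/N_{\Delta t}$, $t_n=n\Delta t$. Constants $C_\partial,C_p,C_{\rm patch}$ do not depend on $h$. (G1) $G_h\cap\partial O_h=G_h\cap\partial O$ and all other vertices lie in $O$. (G2) Every boundary element has at most one face in $\partial O_h$. (G3) $\mathcal T_h$ is conforming with nondegenerate simplices. (G4) $d_H(\partial O,\partial O_h)\le C_\partial h^2$ (Hausdorff distance); there is a map $p_h:\overline O\to\overline O_h$ with $p_h(x_i)=x_i$, $\sup_x|p_h(x)-x|\le C_ph^2$; and with $\mathcal X_h\subset O$ the set of off-grid branch endpoints $\Gamma^{a,j,\pm}_{n,i}(\Delta t)$ with $\chi_j^\pm=0$ (defined below), for every $x\in\mathcal X_h$ and $\ell$ with $\psi_\ell(p_h(x))>0$: $|x_\ell-x|\le C_{\rm patch}h$, $[x,x_\ell]\subset\overline O$, $[x,x_\ell)\subset O$. Interpolation: $I^{\mathrm{sp}}[\Phi](x)=\sum_i\psi_i(p_h(x))\Phi(x_i)$ for $\Phi:G_h\to\mathbb R$; it satisfies $\sup_{x\in\mathcal X_h}|I^{\mathrm{sp}}[\varphi|_{G_h}](x)-\varphi(x)|\le C_Ih^2(\|D\varphi\|_\infty+\|D^2\varphi\|_\infty)$ for $\varphi\in C^2(\overline O)$, with $C_I=C_p+\frac12C_{\rm patch}^2$. **Stopped branches.** For $x_i\in G_h\cap O$, $n<N_{\Delta t}$, $a\in A$, let $\Gamma^{a,j,\pm}_{n,i}(q)=x_i+q\mu(t_n,x_i,a)\pm\sqrt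 q\,\sigma(t_n,x_i,a)\eta_j$, $0\le q\le\Delta t$. If $\{q\in(0,\Delta t]:\Gamma^{a,j,\pm}_{n,i}(q)\notin O\}$ is nonempty, $d_j^\pm$ is its infimum and $\chi_j^\pm=1$; otherwise $d_j^\pm=\Delta t$, $\chi_j^\pm=0$. Put $s_j^\pm=\sqrt{d_j^\pm}$, $\theta_j=s_j^+s_j^-$, $\tau_{n,i}(a)=(\sum_j\rho_j/\theta_j)^{-1}$, $\omega_j^\pm=\tau_{n,i}(a)\rho_j/\bigl(s_j^\pm(s_j^++s_j^-)\bigr)$ (all depend on $n,i,a$). **Test operator.** Let $\mathcal V_j^\pm[\varphi]=I^{\mathrm{sp}}[\varphi(t_{n+1},\cdot)|_{G_h}](\Gamma^{a,j,\pm}_{n,i}(\Delta t))$ if $\chi_j^\pm=0$ and $\mathcal V_j^\pm[\varphi]=\varphi\bigl(t_n+d_j^\pm,\Gamma^{a,j,\pm}_{n,i}(d_j^\pm)\bigr)$ if $\chi_j^\pm=1$, and $$\widehat S^a_{n,i}[\varphi]=\sum_{j=1}^M\sum_\pm\omega_j^\pm\Bigl[\frac{\mathcal V_j^\pm[\varphi]}{1+r(t_n,x_i,a)d_j^\pm}+f(t_n,x_i,a)d_j^\pm\Bigr].$$ *)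

(* Defs.v *)
From HB Require Import structures.
From mathcomp Require Import all_boot all_order all_algebra.
From mathcomp Require Import all_classical all_reals all_analysis.

Set Implicit Arguments.
Unset Strict Implicit.
Unset Printing Implicit Defensive.

Import Order.TTheory GRing.Theory Num.Theory.
Import numFieldNormedType.Exports.

Local Open Scope classical_set_scope.
Local Open Scope ring_scope.

(* The library norm on matrices is the max norm; the Euclidean and Frobenius
   norms are [fnorm]. *)
Definition fnorm (R : realType) (m n : nat) (A : 'M[R]_(m, n)) : R :=
  Num.sqrt (\sum_i \sum_j A i j ^+ 2).

Definition dotp (R : realType) (N : nat) (u v : 'cV[R]_N) : R :=
  \sum_i u i 0 * v i 0.

Definition bdry (T : topologicalType) (S : set T) : set T :=
  closure S `\` interior S.

(* Extended-real valued, so that an unbounded function has supremum +oo. *)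
Definition esup (T : Type) (R : realType) (D : set T) (g : T -> R) : \bar R :=
  ereal_sup [set (g z)%:E | z in D].

Definition diam (R : realType) (N : nat) (S : set 'cV[R]_N) : R :=
  sup [set fnorm (z.1 - z.2) | z in S `*` S].

Definition hausdorff_dist (R : realType) (N : nat) (S1 S2 : set 'cV[R]_N) :
    \bar R :=
  let excess (U V : set 'cV[R]_N) : \bar R :=
    ereal_sup [set ereal_inf [set (fnorm (x - y))%:E | y in V] | x in U] in
  Order.max (excess S1 S2) (excess S2 S1).

(* The coefficients are total functions; they are only constrained on
   [0, T] x closure O. *)
Record problem (R : realType) (N p : nat) := Problem {
  horizon : R;
  domain : set 'cV[R]_N;
  ctrl : metricType R;
  sigma : R -> 'cV[R]_N -> ctrl -> 'M[R]_(N, p);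
  mu : R -> 'cV[R]_N -> ctrl -> 'cV[R]_N;
  rate : R -> 'cV[R]_N -> ctrl -> R;
  cost : R -> 'cV[R]_N -> ctrl -> R
}.

Arguments sigma {R N p} P t x a : rename.
Arguments mu {R N p} P t x a : rename.
Arguments rate {R N p} P t x a : rename.
Arguments cost {R N p} P t x a : rename.

Section Problem.
Variables (R : realType) (N p : nat) (P : problem R N p).

Local Notation O := (domain P).
Local Notation T := (horizon P).
Local Notation spacetime := (R * 'cV[R]_N)%type.

Definition Qcl : set spacetime := `[0, T]%classic `*` closure O.
Definition Qint : set spacetime := `]0, T[%classic `*` O.

Definition parabolic_lipschitz (U : zmodType) (nrm : U -> R) (K : R)
    (g : R -> 'cV[R]_N -> ctrl P -> U) : Prop :=
  forall t x s y a, Qcl (t, x) -> Qcl (s, y) ->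
    nrm (g t x a - g s y a) <= K * (fnorm (x - y) + Num.sqrt `|t - s|).

Definition problem_ok (K0 : R) : Prop :=
  [/\ 0 < T,
      [/\ O !=set0, open O, connected O & bounded_set O],
      [set: ctrl P] !=set0 /\ compact [set: ctrl P],
      0 < K0 &
      [/\ (ereal_sup
             [set esup Qcl (fun z => fnorm (sigma P z.1 z.2 a))
                  + esup Qcl (fun z => fnorm (mu P z.1 z.2 a))
                  + esup Qcl (fun z => `|rate P z.1 z.2 a|%R)
                  + esup Qcl (fun z => `|cost P z.1 z.2 a|%R)
             | a in [set: ctrl P]] <= K0%:E)%E,
          [/\ parabolic_lipschitz (@fnorm R N p) K0 (sigma P),
              parabolic_lipschitz (@fnorm R N 1) K0 (mu P),
              parabolic_lipschitz Num.norm K0 (rate P) &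
              parabolic_lipschitz Num.norm K0 (cost P)],
          forall t x, Qcl (t, x) ->
            [/\ continuous (sigma P t x),
                continuous (mu P t x),
                continuous (rate P t x) &
                continuous (cost P t x)] &
          forall t x a, Qcl (t, x) -> 0 <= rate P t x a]].

(* [None] is the time direction, [Some k] the k-th space direction. *)
Definition dirvec (k : option 'I_N) : spacetime :=
  if k is Some k' then (0, delta_mx k' 0) else (1, 0).

Fixpoint pderiv (s : seq (option 'I_N)) (phi : spacetime -> R) :
    spacetime -> R :=
  if s is k :: s' then (fun z => 'D_(dirvec k) (pderiv s' phi) z) else phi.

(* Smooth on [0, T] x closure O: infinitely differentiable in the interior,
   all derivatives extending continuously to the closed cylinder. *)
Definition smooth_on_Qcl (phi : spacetime -> R) : Prop :=
  {within Qcl, continuous phi} /\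
  forall s : seq (option 'I_N),
    (forall z, Qint z -> differentiable (pderiv s phi) z) /\
    (forall z, Qcl z -> cvg (pderiv s phi @ within Qint (nbhs z))).

(* The continuous extension of a partial derivative to the closed cylinder. *)
Definition pderivcl (s : seq (option 'I_N)) (phi : spacetime -> R)
    (z : spacetime) : R :=
  lim (pderiv s phi @ within Qint (nbhs z)).

Definition ptime (phi : spacetime -> R) z : R := pderivcl [:: None] phi z.
Definition ptime2 (phi : spacetime -> R) z : R := pderivcl [:: None; None] phi z.
Definition grad (phi : spacetime -> R) z : 'cV[R]_N :=
  \col_i pderivcl [:: Some i] phi z.
Definition grad_dt (phi : spacetime -> R) z : 'cV[R]_N :=
  \col_i pderivcl [:: Some i; None] phi z.
Definition hess (phi : spacetime -> R) z : 'M[R]_N :=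
  \matrix_(i, j) pderivcl [:: Some i; Some j] phi z.
Definition third_norm (phi : spacetime -> R) z : R :=
  Num.sqrt (\sum_i \sum_j \sum_k
    pderivcl [:: Some i; Some j; Some k] phi z ^+ 2).

Definition supn (g : spacetime -> R) : R := sup [set g z | z in Qcl].

Definition Fop (a : ctrl P) (phi : spacetime -> R) (t : R) (x : 'cV[R]_N) : R :=
  let A := sigma P t x a *m (sigma P t x a)^T in
  ptime phi (t, x) + 2^-1 * \tr (A *m hess phi (t, x))
  + dotp (mu P t x a) (grad phi (t, x))
  - rate P t x a * phi (t, x) + cost P t x a.

End Problem.

Record cubature (R : realType) (p : nat) := Cubature {
  npts : nat;
  eta : 'I_npts -> 'cV[R]_p;
  rho : 'I_npts -> R
}.

Arguments eta {R p} c j : rename.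
Arguments rho {R p} c j : rename.

Definition cubature_ok (R : realType) (p : nat) (c : cubature R p) : Prop :=
  [/\ (1 <= npts c)%N,
      forall j, eta c j != 0,
      forall j, 0 < rho c j,
      \sum_j rho c j = 1 &
      \sum_j rho c j *: (eta c j *m (eta c j)^T) = 1%:M].

(* An element is given by the set of indices of its vertices; [psi] is the
   nodal basis and [proj] the map p_h. *)
Record mesh (R : realType) (N : nat) := Mesh {
  nvert : nat;
  vert : 'I_nvert -> 'cV[R]_N;
  elems : {set {set 'I_nvert}};
  psi : 'I_nvert -> 'cV[R]_N -> R;
  proj : 'cV[R]_N -> 'cV[R]_N
}.

Arguments vert {R N} m i : rename.
Arguments psi {R N} m i x : rename.
Arguments proj {R N} m x : rename.

Section Mesh.
Variables (R : realType) (N : nat) (m : mesh R N).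
Implicit Types e : {set 'I_(nvert m)}.

Definition hull e : set 'cV[R]_N :=
  [set y | exists l : 'I_(nvert m) -> R,
     [/\ forall i, 0 <= l i, forall i, i \notin e -> l i = 0,
         \sum_i l i = 1 & y = \sum_i l i *: vert m i]].

Definition nondegenerate e : Prop :=
  #|e| = N.+1 /\
  forall l : 'I_(nvert m) -> R, (forall i, i \notin e -> l i = 0) ->
    \sum_i l i = 0 -> \sum_i l i *: vert m i = 0 -> forall i, l i = 0.

(* The elements cover the closure of the polyhedral domain O_h; nondegeneracy
   makes Ohbar the closure of its interior Oh. *)
Definition Ohbar : set 'cV[R]_N := \bigcup_(e in [set` elems m]) hull e.
Definition Oh : set 'cV[R]_N := interior Ohbar.

Definition mesh_size : R := \big[Order.max/0]_(e in elems m) diam (hull e).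

Definition conforming_simplicial : Prop :=
  [/\ injective (vert m),
      forall i, exists2 e, e \in elems m & i \in e,
      forall e, e \in elems m -> nondegenerate e &
      forall e1 e2, e1 \in elems m -> e2 \in elems m ->
        hull e1 `&` hull e2 = hull (e1 :&: e2)].

Definition P1_nodal_basis : Prop :=
  [/\ forall i, {within Ohbar, continuous (psi m i)},
      forall i e, e \in elems m -> exists (g : 'cV[R]_N) (b : R),
        forall y, hull e y -> psi m i y = dotp g y + b &
      forall i k, psi m i (vert m k) = (i == k)%:R].

Definition interp (Phi : 'I_(nvert m) -> R) (x : 'cV[R]_N) : R :=
  \sum_i psi m i (proj m x) * Phi i.

End Mesh.

Section Scheme.
Variables (R : realType) (N p : nat) (P : problem R N p) (c : cubature R p).
Variable (m : mesh R N).

Local Notation O := (domain P).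
Local Notation spacetime := (R * 'cV[R]_N)%type.

Definition timestep (Nt : nat) : R := horizon P / Nt%:R.
Definition tgrid (Nt n : nat) : R := n%:R * timestep Nt.

(* Branch signs: [true] is +, [false] is -. *)
Definition sgn (b : bool) : R := if b then 1 else -1.

Section Node.
Variables (Nt n : nat) (i : 'I_(nvert m)) (a : ctrl P).

Local Notation tn := (tgrid Nt n).
Local Notation xi := (vert m i).

Definition branch (j : 'I_(npts c)) (b : bool) (q : R) : 'cV[R]_N :=
  xi + q *: mu P tn xi a
  + (sgn b * Num.sqrt q) *: (sigma P tn xi a *m eta c j).

Definition exit_times j b : set R :=
  [set q | 0 < q <= timestep Nt /\ ~ O (branch j b q)].

Definition exits j b : bool := `[< exit_times j b !=set0 >].

Definition dur j b : R :=
  if exits j b then inf (exit_times j b) else timestep Nt.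

Definition sdur j b : R := Num.sqrt (dur j b).

Definition theta j : R := sdur j true * sdur j false.

Definition tau : R := (\sum_j rho c j / theta j)^-1.

Definition omega j b : R :=
  tau * rho c j / (sdur j b * (sdur j true + sdur j false)).

Definition branch_value (phi : spacetime -> R) j b : R :=
  if exits j b then phi (tn + dur j b, branch j b (dur j b))
  else interp (fun l => phi (tgrid Nt n.+1, vert m l))
         (branch j b (timestep Nt)).

Definition Shat (phi : spacetime -> R) : R :=
  \sum_j \sum_(b : bool) omega j b *
    (branch_value phi j b / (1 + rate P tn xi a * dur j b)
     + cost P tn xi a * dur j b).

End Node.

Definition offgrid_endpoints (Nt : nat) : set 'cV[R]_N :=
  [set x | exists n i a j b,
     [/\ (n < Nt)%N, O (vert m i), ~~ exits Nt n i a j b,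
         x = branch Nt n i a j b (timestep Nt) & ~ range (vert m) x]].

Definition G1 : Prop :=
  range (vert m) `&` bdry (Oh m) = range (vert m) `&` bdry O /\
  forall i, ~ bdry (Oh m) (vert m i) -> O (vert m i).

Definition G2 : Prop :=
  forall e v w, e \in elems m -> v \in e -> w \in e ->
    hull (m := m) (e :\ v) `<=` bdry (Oh m) ->
    hull (m := m) (e :\ w) `<=` bdry (Oh m) -> v = w.

Definition G3 : Prop := conforming_simplicial m.

Definition G4 (Cbd Cp Cpatch : R) (Nt : nat) : Prop :=
  [/\ (hausdorff_dist (bdry O) (bdry (Oh m)) <= (Cbd * mesh_size m ^+ 2)%:E)%E,
      forall x, closure O x -> Ohbar m (proj m x),
      forall i, proj m (vert m i) = vert m i,
      forall x, closure O x -> fnorm (proj m x - x) <= Cp * mesh_size m ^+ 2 &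
      forall x l, offgrid_endpoints Nt x -> 0 < psi m l (proj m x) ->
        [/\ fnorm (vert m l - x) <= Cpatch * mesh_size m,
            forall s : R, 0 <= s <= 1 ->
              closure O ((1 - s) *: x + s *: vert m l) &
            forall s : R, 0 <= s < 1 -> O ((1 - s) *: x + s *: vert m l)]].

Definition mesh_ok (Cbd Cp Cpatch : R) (Nt : nat) : Prop :=
  [/\ G1, G2, G3, G4 Cbd Cp Cpatch Nt & P1_nodal_basis m].

End Scheme.

(* Main.v *)
Require Import Defs.
From HB Require Import structures.
From mathcomp Require Import all_boot all_order all_algebra.
From mathcomp Require Import all_classical all_reals all_analysis.
From mathcomp Require Import ring lra.
Import Order.TTheory GRing.Theory Num.Theory.
Import numFieldNormedType.Exports.
Local Open Scope classical_set_scope.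
Local Open Scope ring_scope.

(** The scheme is a weighted average over the stopped branches, and the weights
are chosen so that three moments are exact.  With [s = sqrt d] the square root
of the stopping time of a branch, the weights have total mass 1, the terms
[+- s] cancel inside each pair of branches, and the weighted mean of [d] over
the pair [j] is [tau * rho j].  Hence it suffices to expand each branch
separately as [phi + (+- s) * noise + d * drift + error] with [error] at most
a constant times [d] times the bracket of the theorem ([branch_error]):
averaging turns the drifts into [tau * F] by the covariance condition on the
cubature ([mean_drift]) and the errors into at most a constant times [tau]
times the bracket ([omega_average]).

For a single branch, the value at the stopping point is reached in two moves:
along the curve [x + s b + s^2 mu] at the frozen time [t_n], then in time at
the frozen end point.  Going along the space-time curve directly would produce
the derivatives [D^2 d_t phi] and [d_ttt phi], which the bracket does not
contain.  In the parameter [s] the spatial curve is a polynomial, so a third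
order Taylor expansion is available, and [s^3 <= d sqrt(Delta t)].  All Taylor
estimates are nested mean value inequalities ([mvt_bound]).

The test function is differentiable only inside the open cylinder, while the
branches may start at time 0, end at time T and end on the boundary of the
domain.  The expansions are therefore proved at interior points, on slightly
shrunk curves, and pass to the limit: by definition the closed derivative
[pderivcl] is the limit of the interior one along every curve approaching the
point from inside ([pderiv_cvg]).

A branch that does not exit is evaluated by interpolation.  The nodal basis
gives barycentric coordinates on each element ([psi_partition]), so Taylor
expansion from the end point to the vertices leaves an error of order [h^2],
which is [d] times [h^2 / Delta t] since here [d = Delta t].

The suprema in the statement are real-valued, hence informative only for
bounded functions; the closed derivatives are bounded because they are locally
bounded on the compact closed cylinder ([pderivcl_bounded]).  The statement on
the infima follows as the two families differ uniformly by the bracket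
divided by [tau] and the second one is bounded below. *)

(** * Mean value inequality and space-time curves *)

Lemma mvt_bound (R : realType) (g dg : R -> R) (s M : R) : 0 <= s ->
  (forall r, 0 <= r <= s -> is_derive r 1 g (dg r)) ->
  (forall r, 0 <= r <= s -> `|dg r| <= M) -> `|g s - g 0| <= M * s.
Proof.
move=> s0 dgP dgM.
have gc : {within `[0, s], continuous g}.
  apply: continuous_in_subspaceT => r; rewrite inE /= in_itv /= => rs.
  exact/differentiable_continuous/derivable1_diffP/(@ex_derive _ _ _ _ _ _ _ (dgP r rs)).
have dgo r : r \in `]0, s[ -> is_derive r 1 g (dg r).
  by rewrite in_itv /= => /andP[/ltW a /ltW b]; apply: dgP; rewrite a.
have [c cs ->] := MVT_segment s0 dgo gc.
by rewrite subr0 normrM (ger0_norm s0) ler_wpM2r// dgM// -in_itv.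
Qed.

(** The curves along which all expansions are made: linear in time, and
quadratic in space because a branch at time [s ^+ 2] is a polynomial in [s]. *)
Definition qcurve {R : realType} {N : nat} (t dl : R) (x b m : 'cV[R]_N) (s : R) :
  R * 'cV[R]_N := (t + s * dl, x + s *: b + s ^+ 2 *: m).

Lemma diff_dirvec {R : realType} {N : nat} (psi : R * 'cV[R]_N -> R) z (a : R) (v : 'cV[R]_N) :
  differentiable psi z ->
  'd psi z (a, v) = a * 'D_(dirvec R None) psi z +
    \sum_i v i 0 * 'D_(dirvec R (Some i)) psi z.
Proof.
move=> dp.
have -> : (a, v) = a *: dirvec R (N:=N) None + \sum_i v i 0 *: dirvec R (Some i).
  rewrite /dirvec; apply/pair_equal_spec; split => /=.
    rewrite (big_morph (fun w : R * 'cV[R]_N => w.1) (id1:=0) (op1:=+%R)) //=.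
    rewrite big1 ?addr0 => [|i _]; rewrite /= ?scaler0//.
    by rewrite -mulr_algl mulr1 [LHS](esym (mulr1 _)).
  rewrite (big_morph (fun w : R * 'cV[R]_N => w.2) (id1:=0) (op1:=+%R)) //=.
  rewrite scaler0 add0r; apply/matrixP => i j; rewrite summxE ord1 (bigD1 i)//= big1 => [|k ki].
    by rewrite !mxE !eqxx mulr1 addr0.
  by rewrite !mxE eq_sym (negPf ki) mulr0.
rewrite linearD linear_sum linearZ /= deriveE//; congr (_ + _).
by apply: eq_bigr => i _; rewrite linearZ /= deriveE.
Qed.

Lemma is_diff_qcurve {R : realType} {N : nat} t dl (x b m : 'cV[R]_N) (s : R) :
  is_diff s (qcurve t dl x b m) (fun h : R => h *: ((dl, b + (2 * s) *: m) : R * 'cV[R]_N)).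
Proof.
  
  have h1 : is_diff s (fun u : R => t + u * dl) (fun h => h *: dl).
    apply: is_diff_eq.
    by apply/funext => h; rewrite /= [LHS]add0r.
  have h2 : is_diff s (fun u : R => x + u *: b + u ^+ 2 *: m) (fun h => h *: (b + (2 * s) *: m)).
    have h3 : is_diff s (fun u : R => u ^+ 2) (fun h => h * (2 * s)).
      have := @is_diff_mulr R (s, s).
      move=> h4.
      have h5 := is_diff_comp (is_diff_pair (is_diff_id s) (is_diff_id s)) h4.
      have -> : (fun h => h * (2 * s)) = (fun h : R => s * h + h * s).
        by apply/funext => h; ring.
      exact: h5.
    have h5 := is_diff_comp h3 (is_diff_scalel (s ^+ 2) m).
    have h6 : is_diff s (fun u : R => u *: b) (fun h => h *: b) by exact: is_diff_scalel.
    have h7 := is_diffD (is_diffD (is_diff_cst x s) h6) h5.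
    have -> : (fun h => h *: (b + (2 * s) *: m)) = (fun h : R => 0 + h *: b + (h * (2 * s)) *: m).
      by apply/funext => h; rewrite add0r scalerDr scalerA.
    exact: h7.
exact: is_diff_pair.
Qed.

Lemma continuous_qcurve {R : realType} {N : nat} t dl (x b m : 'cV[R]_N) :
  continuous (qcurve t dl x b m).
Proof.
move=> s; have dg := is_diff_qcurve t dl x b m s.
have dd : differentiable (qcurve t dl x b m) s by exact: ex_diff.
exact: differentiable_continuous.
Qed.

Lemma is_derive_qcurve {R : realType} {N : nat} (psi : R * 'cV[R]_N -> R) t dl
    (x b m : 'cV[R]_N) (s : R) :
  differentiable psi (qcurve t dl x b m s) ->
  is_derive s 1 (fun u => psi (qcurve t dl x b m u))
   (dl * 'D_(dirvec R None) psi (qcurve t dl x b m s) +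
    \sum_i (b i 0 + 2 * s * m i 0) * 'D_(dirvec R (Some i)) psi (qcurve t dl x b m s)).
Proof.
move=> dpsi.
have dg := is_diff_qcurve t dl x b m s.
have dc := is_diff_comp dg (differentiableP dpsi).
have dd : differentiable (psi \o qcurve t dl x b m) s by exact: ex_diff.
apply: DeriveDef; first exact: diff_derivable.
rewrite -/(psi \o _) deriveE// diff_val /= scale1r diff_dirvec//.
by congr (_ + _); apply: eq_bigr => i _; rewrite !mxE.
Qed.

(** * Taylor estimates at interior points *)

Lemma qcurve0 {R : realType} {N : nat} t dl (x b m : 'cV[R]_N) :
  qcurve t dl x b m 0 = (t, x).
Proof. by rewrite /qcurve mul0r scale0r expr0n /= scale0r !addr0. Qed.

Lemma norm_sum_le_const {R : realType} {n : nat} (F : 'I_n -> R) (A : R) :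
  (forall i, `|F i| <= A) -> `|\sum_i F i| <= n%:R * A.
Proof.
move=> FA; apply: le_trans (ler_norm_sum _ _ _) _.
apply: le_trans (ler_sum _ (fun i _ => FA i)) _.
by rewrite sumr_const card_ord mulr_natl.
Qed.

(** Subtracting a Taylor polynomial of degree 2 vanishing at 0 reduces each
Taylor estimate to one of lower order for the derivative. *)
Lemma is_derive_sub_quadratic {R : realType} (f : R -> R) (v df c d : R) :
  is_derive v 1 f df ->
  is_derive v 1 (fun u => f u - u * c - u * u * d) (df - c - 2 * v * d).
Proof.
move=> fd.
have id1 := is_derive_id v (1 : R).
have h1 := is_deriveM id1 (is_derive_cst c v (1 : R)).
have h2 := is_deriveM (is_deriveM id1 id1) (is_derive_cst d v (1 : R)).
have h3 := is_deriveB (is_deriveB fd h1) h2.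
have h4 : is_derive v 1 (fun u => f u - u * c - u * u * d) _ := h3.
apply: (is_derive_eq h4).
rewrite /GRing.scale /=; ring.
Qed.

Ltac nonneg := repeat first [done | apply: addr_ge0 | apply: mulr_ge0 | apply: exprn_ge0].

Section InteriorTaylor.
Context {R : realType} {N p : nat} (P : problem R N p).
Variable (phi : R * 'cV[R]_N -> R).
Hypothesis phis : smooth_on_Qcl P phi.

Local Notation D s := (pderiv s phi).

Lemma is_derive_pderiv_qcurve l t dl (x b m : 'cV[R]_N) u : Qint P (qcurve t dl x b m u) ->
  is_derive u 1 (fun u => D l (qcurve t dl x b m u))
   (dl * D (None :: l) (qcurve t dl x b m u) +
    \sum_i (b i 0 + 2 * u * m i 0) * D (Some i :: l) (qcurve t dl x b m u)).
Proof. by move=> Qu; apply: is_derive_qcurve; apply: (phis.2 l).1. Qed.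

Section Space.
Variables (t r B Bm : R) (x b m : 'cV[R]_N).
Hypothesis r01 : 0 <= r <= 1.
Hypothesis B0 : 0 <= B.
Hypothesis Bm0 : 0 <= Bm.
Hypothesis bB : forall i, `|b i 0| <= B.
Hypothesis mB : forall i, `|m i 0| <= Bm.
Hypothesis Qr : forall u : R, 0 <= u <= r -> Qint P (qcurve t 0 x b m u).

Local Notation g := (qcurve t 0 x b m).
Local Notation n := (N%:R : R).

(** The parameter stays below 1, so the velocity [b + 2 u m] is bounded by
[B + 2 Bm]; the bounds [B] and [Bm] are kept apart since the interpolation
error needs the case [Bm = 0] with a small [B]. *)
Lemma curve_lip l (M : R) : 0 <= M ->
  (forall i z, Qint P z -> `|D (Some i :: l) z| <= M) ->
  forall u : R, 0 <= u <= r ->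
  `|D l (g u) - D l (t, x)| <= n * ((B + 2 * Bm) * M) * u.
Proof.
move=> M0 DM u /andP[u0 ur].
rewrite -[in X in _ - X](qcurve0 t 0 x b m).
apply: (mvt_bound _ (fun u => D l (g u)) _ _ _ u0
  (fun v vu => is_derive_pderiv_qcurve l _ _ _ _ _ _ (Qr _ _))) => v /andP[v0 vu].
  by rewrite v0 (le_trans vu).
have v1 : v <= 1 by case/andP: r01 => _; apply: le_trans; exact: le_trans ur.
rewrite mul0r add0r; apply: norm_sum_le_const => i.
rewrite normrM ler_pM// ?DM//; last by apply: Qr; rewrite v0 (le_trans vu).
apply: (le_trans (ler_normD _ _)); rewrite lerD// !normrM ger0_norm// (ger0_norm v0).
by rewrite -[leRHS]mulr1 mulrAC ler_pM// ?mulr_ge0// ler_pM2l.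
Qed.

(** The derivative of the remainder splits into the part of the velocity that
is constant, against an increment of the gradient, and the part [2 u m] that
already vanishes at 0. *)
Lemma curve_taylor1 l (M1 M2 : R) : 0 <= M1 -> 0 <= M2 ->
  (forall i z, Qint P z -> `|D (Some i :: l) z| <= M1) ->
  (forall i k z, Qint P z -> `|D (Some k :: Some i :: l) z| <= M2) ->
  forall u : R, 0 <= u <= r ->
  `|D l (g u) - D l (t, x) - u * \sum_i b i 0 * D (Some i :: l) (t, x)|
   <= (n * (B * (n * ((B + 2 * Bm) * M2))) + n * (2 * Bm * M1)) * u ^+ 2.
Proof.
move=> M10 M20 DM1 DM2 u /andP[u0 ur].
set c := \sum_i _; set K := (X in _ <= X * _).
have K0 : 0 <= K by rewrite /K; nonneg.
have -> : D l (g u) - D l (t, x) - u * c = (D l (g u) - u * c) - (D l (g 0) - 0 * c).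
  by rewrite qcurve0 mul0r subr0; ring.
rewrite expr2 mulrA.
pose dg v := \sum_i (b i 0 + 2 * v * m i 0) * D (Some i :: l) (g v) - c.
apply: (mvt_bound _ (fun v => D l (g v) - v * c) dg _ _ u0) => v /andP[v0 vu].
  have Qv : Qint P (g v) by apply: Qr; rewrite v0 (le_trans vu).
  have h := is_derive_pderiv_qcurve l _ _ _ _ _ _ Qv.
  rewrite mul0r add0r in h.
  have := is_derive_sub_quadratic _ _ _ c 0 h; rewrite mulr0 subr0.
  by under eq_fun do rewrite mulr0 subr0.
have v1 : v <= 1 by case/andP: r01 => _; apply: le_trans; exact: le_trans ur.
have vr : v <= r by exact: le_trans ur.
have -> : dg v = \sum_i b i 0 * (D (Some i :: l) (g v) - D (Some i :: l) (t, x))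
   + \sum_i (2 * m i 0 * D (Some i :: l) (g v)) * v.
  rewrite /dg /c -sumrB -big_split /=; apply: eq_bigr => i _; ring.
apply: (@le_trans _ _ (K * v)); last by rewrite ler_wpM2l.
rewrite /K mulrDl; apply: (le_trans (ler_normD _ _)); apply: lerD.
  rewrite -mulrA; apply: norm_sum_le_const => i; rewrite normrM -mulrA ler_pM//.
  by apply: curve_lip => //; [move=> k z; exact: DM2 | rewrite v0].
rewrite -mulrA; apply: norm_sum_le_const => i; rewrite 3!normrM (ger0_norm v0).
rewrite ler_wpM2r// ler_pM// ?mulr_ge0// ?DM1//; last by apply: Qr; rewrite v0.
by rewrite ger0_norm// ler_pM2l.
Qed.

(** Same splitting one order higher; the acceleration [m] of the curve
contributes its own first-order term at order 2. *)
Lemma curve_taylor2 l (M2 M3 : R) : 0 <= M2 -> 0 <= M3 ->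
  (forall i k z, Qint P z -> `|D (Some k :: Some i :: l) z| <= M2) ->
  (forall i k j z, Qint P z -> `|D (Some j :: Some k :: Some i :: l) z| <= M3) ->
  `|D l (g r) - D l (t, x) - r * \sum_i b i 0 * D (Some i :: l) (t, x)
    - r ^+ 2 * (\sum_i m i 0 * D (Some i :: l) (t, x)
       + 2^-1 * \sum_i b i 0 * \sum_k b k 0 * D (Some k :: Some i :: l) (t, x))|
   <= (n * (B * (n * (B * (n * ((B + 2 * Bm) * M3))) + n * (2 * Bm * M2)))
      + n * (2 * Bm * (n * ((B + 2 * Bm) * M2)))) * r ^+ 3.
Proof.
move=> M20 M30 DM2 DM3.
set c := \sum_i b i 0 * D (Some i :: l) (t, x).
set e1 := \sum_i m i 0 * _; set e2 := \sum_i b i 0 * _.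
set d := e1 + _; set K := (X in _ <= X * _).
have K0 : 0 <= K by rewrite /K; nonneg.
case/andP: (r01) => r0 r1.
have -> : D l (g r) - D l (t, x) - r * c - r ^+ 2 * d =
   (D l (g r) - r * c - r * r * d) - (D l (g 0) - 0 * c - 0 * 0 * d).
  by rewrite qcurve0; ring.
have -> : K * r ^+ 3 = K * r ^+ 2 * r by ring.
pose dg v := \sum_i (b i 0 + 2 * v * m i 0) * D (Some i :: l) (g v) - c - 2 * v * d.
apply: (mvt_bound _ (fun v => D l (g v) - v * c - v * v * d) dg _ _ r0) => v /andP[v0 vr].
  have Qv : Qint P (g v) by apply: Qr; rewrite v0.
  have h := is_derive_pderiv_qcurve l _ _ _ _ _ _ Qv.
  rewrite mul0r add0r in h.
  exact: is_derive_sub_quadratic h.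
have v1 : v <= 1 by exact: le_trans r1.
have -> : dg v = \sum_i b i 0 * (D (Some i :: l) (g v) - D (Some i :: l) (t, x) -
      v * \sum_k b k 0 * D (Some k :: Some i :: l) (t, x))
   + \sum_i (2 * m i 0 * (D (Some i :: l) (g v) - D (Some i :: l) (t, x))) * v.
  rewrite /dg /d mulrDr mulrA (_ : 2 * v * 2^-1 = v); last by field.
  rewrite /c /e1 /e2 !mulr_sumr opprD addrA -!sumrB -big_split /=; apply: eq_bigr => i _; ring.
apply: (@le_trans _ _ (K * v ^+ 2)); last by rewrite ler_wpM2l// lerXn2r ?nnegrE.
rewrite /K mulrDl; apply: (le_trans (ler_normD _ _)); apply: lerD.
  rewrite -mulrA; apply: norm_sum_le_const => i; rewrite normrM -mulrA ler_pM//.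
  by apply: curve_taylor1 => //; [move=> k z; exact: DM2 | move=> k j z; exact: DM3 | rewrite v0].
rewrite -mulrA; apply: norm_sum_le_const => i; rewrite normrM (ger0_norm v0) expr2 [leRHS]mulrA.
rewrite ler_wpM2r// 2!normrM -[leRHS]mulrA ler_pM//.
  by rewrite ger0_norm// ler_pM2l.
by apply: curve_lip => //; [move=> k z; exact: DM2 | rewrite v0].
Qed.

End Space.

Section Time.
Variables (t dl : R) (x : 'cV[R]_N).
Hypothesis dl0 : 0 <= dl.
Hypothesis Qt : forall u : R, 0 <= u <= dl -> Qint P (t + u, x).

Lemma time_lip l (M : R) : (forall z, Qint P z -> `|D (None :: l) z| <= M) ->
  forall u : R, 0 <= u <= dl -> `|D l (t + u, x) - D l (t, x)| <= M * u.
Proof.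
have E u : qcurve t 1 x 0 0 u = (t + u, x) by rewrite /qcurve mulr1 !scaler0 !addr0.
move=> DM u /andP[u0 ud]; rewrite -(qcurve0 t 1 x 0 0) -E.
apply: (mvt_bound _ (fun u => D l (qcurve t 1 x 0 0 u)) _ _ _ u0
  (fun v vu => is_derive_pderiv_qcurve l _ _ _ _ _ _ _)) => v /andP[v0 vu].
  by rewrite E; apply: Qt; rewrite v0 (le_trans vu).
rewrite mul1r big1 ?addr0 => [|i _]; last by rewrite !mxE mulr0 addr0 mul0r.
by apply: DM; rewrite E; apply: Qt; rewrite v0 (le_trans vu).
Qed.

Lemma time_taylor l (M : R) : 0 <= M ->
  (forall z, Qint P z -> `|D (None :: None :: l) z| <= M) ->
  `|D l (t + dl, x) - D l (t, x) - dl * D (None :: l) (t, x)| <= M * dl ^+ 2.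
Proof.
have E u : qcurve t 1 x 0 0 u = (t + u, x) by rewrite /qcurve mulr1 !scaler0 !addr0.
move=> M0 DM; set c := D (None :: l) (t, x).
have -> : D l (t + dl, x) - D l (t, x) - dl * c =
  (D l (qcurve t 1 x 0 0 dl) - dl * c) - (D l (qcurve t 1 x 0 0 0) - 0 * c).
  by rewrite qcurve0 E mul0r subr0; ring.
rewrite expr2 mulrA.
pose dg v := D (None :: l) (t + v, x) - c.
apply: (mvt_bound _ (fun v => D l (qcurve t 1 x 0 0 v) - v * c) dg _ _ dl0) => v /andP[v0 vu].
  have Qv : Qint P (qcurve t 1 x 0 0 v) by rewrite E; apply: Qt; rewrite v0.
  have h := is_derive_pderiv_qcurve l _ _ _ _ _ _ Qv.
  rewrite mul1r big1 ?addr0 E in h; last by move=> i _; rewrite !mxE mulr0 addr0 mul0r.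
  have := is_derive_sub_quadratic _ _ _ c 0 h; rewrite mulr0 subr0.
  by under eq_fun do rewrite mulr0 subr0.
apply: (@le_trans _ _ (M * v)); last by rewrite ler_wpM2l.
by apply: time_lip => //; rewrite v0.
Qed.

End Time.

End InteriorTaylor.

(** * Extension of derivatives to the closed cylinder *)

Lemma cvg_finsum {R : realType} {I : Type} {F : set_system I} {FF : Filter F} {n : nat}
    (f : 'I_n -> I -> R) (a : 'I_n -> R) :
  (forall i, f i @ F --> a i) -> (fun u => \sum_i f i u) @ F --> \sum_i a i.
Proof.
elim: n f a => [|n IH] f a fa.
  by under eq_fun do rewrite big_ord0; rewrite big_ord0; exact: cvg_cst.
under eq_fun do rewrite big_ord_recl; rewrite big_ord_recl.
by apply: cvgD => //; exact: IH.
Qed.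

Section Extension.
Context {R : realType} {N p : nat} (P : problem R N p).
Variable (phi : R * 'cV[R]_N -> R).
Hypothesis phis : smooth_on_Qcl P phi.
Hypothesis openO : open (domain P).

Local Notation D s := (pderiv s phi).
Local Notation Dcl s := (pderivcl P s phi).
Local Notation T := (horizon P).

Lemma QintE t x : Qint P (t, x) <-> 0 < t < T /\ domain P x.
Proof. by rewrite /Qint /= in_itv. Qed.

Lemma QclE t x : Qcl P (t, x) <-> 0 <= t <= T /\ closure (domain P) x.
Proof. by rewrite /Qcl /= in_itv. Qed.

Lemma open_Qint : open (Qint P).
Proof.
rewrite openE => -[t x] /= [] /= tT Ox; exists (`]0, T[%classic, domain P) => //=.
by split; apply: open_nbhs_nbhs; split => //; exact: interval_open.
Qed.

Lemma Qint_Qcl z : Qint P z -> Qcl P z.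
Proof.
case: z => t x /QintE[/andP[t0 tT] Ox]; apply/QclE; split; first by rewrite !ltW.
exact: subset_closure.
Qed.

Lemma pderivclE l z : Qint P z -> Dcl l z = D l z.
Proof.
move=> Qz; rewrite /pderivcl within_interior; last first.
  by have := open_Qint; rewrite openE => /(_ _ Qz).
by apply: cvg_lim => //; apply: differentiable_continuous; apply: (phis.2 l).1.
Qed.

(** This replaces continuity of the extended derivative: a limit along a
filter inside the open cylinder already gives the extended value. *)
Lemma pderiv_cvg l {I : Type} (F : set_system I) {FF : Filter F} (c : I -> R * 'cV[R]_N) z :
  Qcl P z -> c @ F --> z -> (\forall e \near F, Qint P (c e)) ->
  (fun e => D l (c e)) @ F --> Dcl l z.
Proof.
move=> Qz cz Qc A /((phis.2 l).2 z Qz) /= DA.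
have h : F (fun e => Qint P (c e) -> A (D l (c e))) := cz _ DA.
change (F (fun e => A (D l (c e)))).
move: h Qc; refine (@filterS2 I F FF _ _ _ _) => e h; exact: h.
Qed.

Lemma phi_cvg {I : Type} (F : set_system I) {FF : Filter F} (c : I -> R * 'cV[R]_N) z :
  Qcl P z -> c @ F --> z -> (\forall e \near F, Qint P (c e)) ->
  (fun e => phi (c e)) @ F --> phi z.
Proof.
move=> Qz cz Qc; have /subspace_continuousP h := phis.1.
move=> A /(h z Qz) /= DA.
have h' : F (fun e => Qcl P (c e) -> A (phi (c e))) := cz _ DA.
change (F (fun e => A (phi (c e)))).
move: h' Qc; refine (@filterS2 I F FF _ _ _ _) => e he Qe; exact: he (Qint_Qcl _ Qe).
Qed.

End Extension.

(** * Taylor estimates up to the boundary *)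

Lemma cvg_right0_affine {R : realType} (a b : R) : (fun e => a + e * b) e @[e --> 0^'+] --> a.
Proof.
apply: cvg_at_right_filter.
have h : (fun x : R => x * b) @ (0:R) --> 0 * b.
  apply: (@cvgMr_tmp R R (nbhs (0:R)) _ idfun 0 b); exact: cvg_id.
have h' := cvgD (@cvg_cst _ a _ (nbhs (0 : R)) _) h.
rewrite mul0r addr0 in h'; exact: h'.
Qed.

Section Closure.
Context {R : realType} {N p : nat} (P : problem R N p).
Variable (phi : R * 'cV[R]_N -> R).
Hypothesis phis : smooth_on_Qcl P phi.

Local Notation D s := (pderiv s phi).
Local Notation Dcl s := (pderivcl P s phi).
Local Notation T := (horizon P).
Local Notation O := (domain P).
Local Notation n := (N%:R : R).

Variables M1 M2 M3 Mt Mtt Mtd : R.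
Hypothesis M10 : 0 <= M1.
Hypothesis M20 : 0 <= M2.
Hypothesis M30 : 0 <= M3.
Hypothesis Mtt0 : 0 <= Mtt.
Hypothesis Mtd0 : 0 <= Mtd.
Hypothesis DM1 : forall i z, Qint P z -> `|D [:: Some i] z| <= M1.
Hypothesis DM2 : forall i k z, Qint P z -> `|D [:: Some k; Some i] z| <= M2.
Hypothesis DM3 : forall i k j z, Qint P z ->
  `|D [:: Some j; Some k; Some i] z| <= M3.
Hypothesis DMt : forall z, Qint P z -> `|D [:: None] z| <= Mt.
Hypothesis DMtt : forall z, Qint P z -> `|D [:: None; None] z| <= Mtt.
Hypothesis DMtd : forall i z, Qint P z -> `|D [:: Some i; None] z| <= Mtd.

Section Branch.
Variables (B Bm : R) (x b m : 'cV[R]_N).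
Hypothesis B0 : 0 <= B.
Hypothesis Bm0 : 0 <= Bm.
Hypothesis bB : forall i, `|b i 0| <= B.
Hypothesis mB : forall i, `|m i 0| <= Bm.

(** The coefficient of [s ^+ 2] in the expansion along the curve.  The table
[E] of partial derivatives is abstract because the same expression is used
for interior derivatives and for their extensions. *)
Definition quad_part (b m : 'cV[R]_N) (E : seq (option 'I_N) -> R) : R :=
  \sum_i m i 0 * E [:: Some i]
  + 2^-1 * \sum_i b i 0 * \sum_k b k 0 * E [:: Some k; Some i].

Let y (s : R) := x + s *: b + s ^+ 2 *: m.

Let K3 := n * (B * (n * (B * (n * ((B + 2 * Bm) * M3))) + n * (2 * Bm * M2)))
      + n * (2 * Bm * (n * ((B + 2 * Bm) * M2))).

(** Space at frozen time, then time at the frozen end point; moving the time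
derivative back to the starting point costs only [D d_t phi]. *)
Lemma branch_interior t dl r : 0 < t -> 0 <= dl -> t + dl < T -> 0 <= r <= 1 ->
  (forall u : R, 0 <= u <= r -> O (y u)) ->
  `|phi (t + dl, y r) - phi (t, x) - (r * \sum_i b i 0 * D [:: Some i] (t, x)
     + r ^+ 2 * quad_part b m (fun l => D l (t, x)) + dl * D [:: None] (t, x))|
   <= K3 * r ^+ 3 + (Mtt * dl ^+ 2 + dl * (n * ((B + 2 * Bm) * Mtd) * r)) /\
  `|phi (t + dl, y r) - phi (t, x)| <= n * ((B + 2 * Bm) * M1) * r + Mt * dl.
Proof.
move=> t0 dl0 tT r01 Oy.
have tT' : t < T by lra.
have r0 : 0 <= r by case/andP: r01.
have Qy u : 0 <= u <= r -> Qint P (qcurve t 0 x b m u).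
  by move=> ur; rewrite /qcurve mulr0 addr0; apply/QintE; rewrite t0 tT'; split=> //; exact: Oy.
have Qt u : 0 <= u <= dl -> Qint P (t + u, y r).
  move=> /andP[u0 ud]; apply/QintE; split; last by apply: Oy; rewrite lexx r0.
  apply/andP; split; lra.
have E : qcurve t 0 x b m r = (t, y r) by rewrite /qcurve mulr0 addr0.
have rr : 0 <= r <= r by rewrite r0 lexx.
split.
  have h1 := curve_taylor2 P phi phis t r B Bm x b m r01 B0 Bm0 bB mB Qy [::] M2 M3 M20 M30 DM2 DM3.
  have h2 := time_taylor P phi phis t dl (y r) dl0 Qt [::] Mtt Mtt0 DMtt.
  have h3 := curve_lip P phi phis t r B Bm x b m r01 bB mB Qy [:: None] Mtd Mtd0 DMtd r rr.
  rewrite E in h1 h3.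
  set A := quad_part _ _ _; set C := \sum_i _; set D0 := D [:: None] (t, x).
  have -> : phi (t + dl, y r) - phi (t, x) - (r * C + r ^+ 2 * A + dl * D0) =
     (D [::] (t, y r) - D [::] (t, x) - r * C - r ^+ 2 * A) +
     ((D [::] (t + dl, y r) - D [::] (t, y r) - dl * D [:: None] (t, y r)) +
     dl * (D [:: None] (t, y r) - D0)) by rewrite /=; ring.
  apply: le_trans (ler_normD _ _) _; apply: lerD; first exact: h1.
  apply: le_trans (ler_normD _ _) _; apply: lerD; first exact: h2.
  by rewrite normrM ger0_norm// ler_wpM2l.
have h1 := curve_lip P phi phis t r B Bm x b m r01 bB mB Qy [::] M1 M10 DM1 r rr.
have h2 := time_lip P phi phis t dl (y r) Qt [::] Mt DMt dl.
rewrite E in h1.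
have -> : phi (t + dl, y r) - phi (t, x) =
  (D [::] (t, y r) - D [::] (t, x)) + (D [::] (t + dl, y r) - D [::] (t, y r)) by rewrite /=; ring.
apply: le_trans (ler_normD _ _) _; apply: lerD; first exact: h1.
by apply: h2; rewrite dl0 lexx.
Qed.

Lemma cvg_path (s : R) : (fun e => y (s - e)) @ 0^'+ --> y s.
Proof.
have c1 : (fun e : R => s + e * (-1)) @ (0 : R)^'+ --> s by exact: cvg_right0_affine.
have c2 : (qcurve 0 0 x b m) @ s --> qcurve 0 0 x b m s by exact: continuous_qcurve.
have c3 := cvg_comp _ _ c1 c2.
have c5 : (fun z : R * 'cV[R]_N => z.2) @ qcurve 0 0 x b m s --> y s by exact: cvg_snd.
have c4 := cvg_comp _ _ c3 c5.
move: c4; rewrite /comp/=.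
by under eq_fun do rewrite mulrN1.
Qed.

Lemma near_path_in (s : R) : 0 < s -> (forall u : R, 0 <= u < s -> O (y u)) ->
  \forall e \near (0 : R)^'+, O (y (s - e)).
Proof.
move=> s0 Oy; apply: filterS2 (nbhs_right_gt (0 : R)) (nbhs_right_lt s0) => e e0 es.
by apply: Oy; apply/andP; split; lra.
Qed.

Lemma closure_path (s : R) : 0 < s -> (forall u : R, 0 <= u < s -> O (y u)) ->
  closure O (y s).
Proof.
move=> s0 Oy.
apply: (closed_cvg (F := (0 : R)^'+) (u_ := fun e => y (s - e)) _ (@closed_closure _ O) _ _ (cvg_path s)).
by apply: filterS (near_path_in _ s0 Oy) => e; exact: subset_closure.
Qed.

Lemma cvg_quad_part {I} (F : set_system I) {FF : Filter F}
    (E : seq (option 'I_N) -> I -> R) (e : seq (option 'I_N) -> R) :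
  (forall l, E l @ F --> e l) ->
  (fun u => quad_part b m (fun l => E l u)) @ F --> quad_part b m e.
Proof.
move=> Ee; apply: cvgD.
  by apply: cvg_finsum => i; apply: cvgMl_tmp.
apply: cvgMl_tmp; apply: cvg_finsum => i; apply: cvgMl_tmp.
by apply: cvg_finsum => k; apply: cvgMl_tmp.
Qed.

(** Start slightly after [t], stop slightly before [s], and shorten the time
move on both sides; the estimate passes to the limit. *)
Lemma branch_closure t dl s : 0 <= t -> 0 < dl -> t + dl <= T -> 0 < s <= 1 ->
  (forall u : R, 0 <= u < s -> O (y u)) ->
  `|phi (t + dl, y s) - phi (t, x) - (s * \sum_i b i 0 * Dcl [:: Some i] (t, x)
     + s ^+ 2 * quad_part b m (fun l => Dcl l (t, x)) + dl * Dcl [:: None] (t, x))|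
   <= K3 * s ^+ 3 + (Mtt * dl ^+ 2 + dl * (n * ((B + 2 * Bm) * Mtd) * s)) /\
  `|phi (t + dl, y s) - phi (t, x)| <= n * ((B + 2 * Bm) * M1) * s + Mt * dl.
Proof.
move=> t0 dl0 tT /andP[s0 s1] Oy.
have Ox : O x by have := Oy 0; rewrite lexx s0 /y expr0n /= !scale0r !addr0; apply.
have yn := near_path_in _ s0 Oy.
have Cy := closure_path _ s0 Oy.
have ct0 : (fun e : R => t + e * 1) @ (0 : R)^'+ --> t by exact: cvg_right0_affine.
have ct1 : (fun e : R => (t + dl) + e * (-1)) @ (0 : R)^'+ --> t + dl by exact: cvg_right0_affine.
have cs : (fun e : R => s + e * (-1)) @ (0 : R)^'+ --> s by exact: cvg_right0_affine.
have cd : (fun e : R => dl + e * (-2)) @ (0 : R)^'+ --> dl by exact: cvg_right0_affine.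
pose c0 e : R * 'cV[R]_N := (t + e * 1, x).
pose c1 e : R * 'cV[R]_N := ((t + dl) + e * (-1), y (s - e)).
have cc0 : c0 @ (0 : R)^'+ --> (t, x).
  by apply: (cvg_pair (G := nbhs t) (H := nbhs x)) => //; exact: cvg_cst.
have cc1 : c1 @ (0 : R)^'+ --> (t + dl, y s).
  by apply: (cvg_pair (G := nbhs (t + dl)) (H := nbhs (y s))) => //; exact: cvg_path.
have near_e : \forall e \near (0 : R)^'+, [/\ 0 < e, e < s & 2 * e < dl].
  have d2 : 0 < dl / 2 by exact: divr_gt0.
  apply: filterS3 (nbhs_right_gt (0 : R)) (nbhs_right_lt s0) (nbhs_right_lt d2) => e e0 es ed.
  by split => //; rewrite mulrC -ltr_pdivlMr.
have Qc0 : \forall e \near (0 : R)^'+, Qint P (c0 e).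
  apply: filterS near_e => e [e0 es ed]; apply/QintE; split => //; apply/andP; split; lra.
have Qc1 : \forall e \near (0 : R)^'+, Qint P (c1 e).
  apply: filterS2 near_e yn => e [e0 es ed] ?; apply/QintE; split => //; apply/andP; split; lra.
have Qz0 : Qcl P (t, x).
  by apply/QclE; split; [apply/andP; split; lra|exact: subset_closure].
have Qz1 : Qcl P (t + dl, y s).
  by apply/QclE; split => //; apply/andP; split; lra.
have fc0 : (fun e => phi (c0 e)) @ (0 : R)^'+ --> phi (t, x) by exact: (phi_cvg P).
have fc1 : (fun e => phi (c1 e)) @ (0 : R)^'+ --> phi (t + dl, y s) by exact: (phi_cvg P).
have dc0 l : (fun e => D l (c0 e)) @ (0 : R)^'+ --> Dcl l (t, x) by exact: pderiv_cvg.
pose lhs e := phi (c1 e) - phi (c0 e)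
  - ((s + e * (-1)) * \sum_i b i 0 * D [:: Some i] (c0 e)
     + (s + e * (-1)) ^+ 2 * quad_part b m (fun l => D l (c0 e))
     + (dl + e * (-2)) * D [:: None] (c0 e)).
pose rhs e := K3 * (s + e * (-1)) ^+ 3 + (Mtt * (dl + e * (-2)) ^+ 2
  + (dl + e * (-2)) * (n * ((B + 2 * Bm) * Mtd) * (s + e * (-1)))).
have main e : 0 < e -> e < s -> 2 * e < dl -> `|lhs e| <= rhs e /\
  `|phi (c1 e) - phi (c0 e)| <= n * ((B + 2 * Bm) * M1) * (s + e * (-1)) + Mt * (dl + e * (-2)).
  move=> e0 es ed; rewrite /lhs /rhs.
  have -> : c1 e = ((t + e * 1) + (dl + e * (-2)), y (s + e * (-1))).
    rewrite /c1 mulrN1; congr pair; ring.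
  apply: branch_interior; [lra..| |] => [|u]; first by apply/andP; split; lra.
  by move=> /andP[u0 us]; apply: Oy; rewrite u0 /=; lra.
have cX k : (fun e : R => (s + e * (-1)) ^+ k) @ (0 : R)^'+ --> s ^+ k.
  elim: k => [|k IH]; first by rewrite expr0; under eq_fun do rewrite expr0; exact: cvg_cst.
  by rewrite exprS; under eq_fun do rewrite exprS; exact: cvgM.
have cd2 : (fun e : R => (dl + e * (-2)) ^+ 2) @ (0 : R)^'+ --> dl ^+ 2.
  by rewrite expr2; under eq_fun do rewrite expr2; exact: cvgM.
split.
  apply: (ler_cvg_to (a := (0 : R)^'+) _ _ (f := fun e => `|lhs e|) (g := rhs)).
  - apply: cvg_norm; apply: (cvgB (cvgB fc1 fc0)).
    apply: cvgD; first (apply: cvgD; apply: cvgM => //).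
    + by apply: cvg_finsum => i; apply: cvgMl_tmp; exact: dc0.
    + by apply: cvg_quad_part => l; exact: dc0.
    + by apply: cvgM => //; exact: dc0.
  - apply: cvgD; first by apply: cvgMl_tmp.
    by apply: cvgD; [exact: cvgMl_tmp|apply: cvgM => //; exact: cvgMl_tmp].
  - by apply: filterS near_e => e [e0 es ed]; exact: (main _ _ _ _).1.
apply: (ler_cvg_to (a := (0 : R)^'+) _ _ (f := fun e => `|phi (c1 e) - phi (c0 e)|)
     (g := fun e => n * ((B + 2 * Bm) * M1) * (s + e * (-1)) + Mt * (dl + e * (-2)))).
- by apply: cvg_norm; exact: (cvgB fc1 fc0).
- by apply: cvgD; exact: cvgMl_tmp.
- by apply: filterS near_e => e [e0 es ed]; exact: (main _ _ _ _).2.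
Qed.

End Branch.

(** The vertex reached by the segment may lie on the boundary and [t] may be
the final time, hence the same limiting argument. *)
Lemma segment_closure (B t : R) (x b : 'cV[R]_N) : 0 <= B ->
  (forall i, `|b i 0| <= B) -> 0 < t <= T ->
  (forall u : R, 0 <= u < 1 -> O (x + u *: b)) ->
  `|phi (t, x + b) - phi (t, x) - \sum_i b i 0 * Dcl [:: Some i] (t, x)|
   <= n * (B * (n * (B * M2))).
Proof.
move=> B0 bB /andP[t0 tT] Oy.
pose y (u : R) := x + u *: b + u ^+ 2 *: 0.
have yE u : y u = x + u *: b by rewrite /y scaler0 addr0.
have cy : (fun e => y (1 - e)) @ (0 : R)^'+ --> x + b.
  have := cvg_path x b 0 1; rewrite scale1r scaler0 addr0; exact.
have Ox : O x by have := Oy 0; rewrite lexx ltr01 scale0r addr0; apply.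
have near_e : \forall e \near (0 : R)^'+, [/\ 0 < e, e < 1 & e < t].
  apply: filterS3 (nbhs_right_gt (0 : R)) (nbhs_right_lt ltr01) (nbhs_right_lt t0) => e e0 es ed.
  by split.
have yn : \forall e \near (0 : R)^'+, O (y (1 - e)).
  apply: filterS near_e => e [e0 e1 et]; rewrite yE; apply: Oy; apply/andP; split; lra.
have Cy : closure O (x + b).
  apply: (closed_cvg (F := (0 : R)^'+) (u_ := fun e => y (1 - e)) _ (@closed_closure _ O) _ _ cy).
  by apply: filterS yn => e; exact: subset_closure.
have ct0 : (fun e : R => t + e * (-1)) @ (0 : R)^'+ --> t by exact: cvg_right0_affine.
have cs : (fun e : R => 1 + e * (-1)) @ (0 : R)^'+ --> (1 : R) by exact: cvg_right0_affine.
pose c0 e : R * 'cV[R]_N := (t + e * (-1), x).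
pose c1 e : R * 'cV[R]_N := (t + e * (-1), y (1 - e)).
have cc0 : c0 @ (0 : R)^'+ --> (t, x).
  by apply: (cvg_pair (G := nbhs t) (H := nbhs x)) => //; exact: cvg_cst.
have cc1 : c1 @ (0 : R)^'+ --> (t, x + b).
  by apply: (cvg_pair (G := nbhs t) (H := nbhs (x + b))).
have Qc0 : \forall e \near (0 : R)^'+, Qint P (c0 e).
  apply: filterS near_e => e [e0 es ed]; apply/QintE; split => //; apply/andP; split; lra.
have Qc1 : \forall e \near (0 : R)^'+, Qint P (c1 e).
  apply: filterS2 near_e yn => e [e0 es ed] ?; apply/QintE; split => //; apply/andP; split; lra.
have Qz0 : Qcl P (t, x).
  by apply/QclE; split; [apply/andP; split; lra|exact: subset_closure].
have Qz1 : Qcl P (t, x + b).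
  by apply/QclE; split => //; apply/andP; split; lra.
have fc0 : (fun e => phi (c0 e)) @ (0 : R)^'+ --> phi (t, x) by exact: (phi_cvg P).
have fc1 : (fun e => phi (c1 e)) @ (0 : R)^'+ --> phi (t, x + b) by exact: (phi_cvg P).
have dc0 l : (fun e => D l (c0 e)) @ (0 : R)^'+ --> Dcl l (t, x) by exact: pderiv_cvg.
set K := n * _; have K0 : 0 <= K by rewrite /K !mulr_ge0.
have main e : 0 < e -> e < 1 -> e < t ->
  `|phi (c1 e) - phi (c0 e) - (1 + e * (-1)) * \sum_i b i 0 * D [:: Some i] (c0 e)| <= K.
  move=> e0 e1 et.
  have r01 : 0 <= 1 + e * (-1) <= 1 by apply/andP; split; lra.
  have rr : 0 <= 1 + e * (-1) <= 1 + e * (-1) by case/andP: r01 => -> _; rewrite lexx.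
  have mB (i : 'I_N) : `|(0 : 'cV[R]_N) i 0| <= 0 by rewrite mxE normr0.
  have Qy u : 0 <= u <= 1 + e * (-1) -> Qint P (qcurve (t + e * (-1)) 0 x b 0 u).
    move=> /andP[u0 u1]; rewrite /qcurve mulr0 addr0; apply/QintE; split; first by apply/andP; split; lra.
    by rewrite scaler0 addr0; apply: Oy; apply/andP; split; lra.
  have h := curve_taylor1 P phi phis (t + e * (-1)) (1 + e * (-1)) B 0 x b 0
    r01 B0 (lexx 0) bB mB Qy [::] M1 M2 M10 M20 DM1 DM2 _ rr.
  have E : qcurve (t + e * (-1)) 0 x b 0 (1 + e * (-1)) = c1 e.
    by rewrite /qcurve /c1 mulr0 addr0 mulrN1.
  rewrite E in h; apply: le_trans h _.
  rewrite mulr0 addr0 mul0r mulr0 addr0 -/K -[leRHS]mulr1 ler_wpM2l//.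
  by rewrite exprn_ile1//; case/andP: r01.
apply: (ler_cvg_to (a := (0 : R)^'+) _ _ (g := fun e => K) (f := fun e =>
  `|phi (c1 e) - phi (c0 e) - (1 + e * (-1)) * \sum_i b i 0 * D [:: Some i] (c0 e)|)).
- apply: cvg_norm; apply: (cvgB (cvgB fc1 fc0)).
  rewrite -[X in _ --> X]mul1r; apply: cvgM => //.
  by apply: cvg_finsum => i; apply: cvgMl_tmp; exact: dc0.
- exact: cvg_cst.
- by apply: filterS near_e => e [e0 es ed]; exact: main.
Qed.

End Closure.

(** * Boundedness of the closed derivatives *)

Lemma trmx_continuous {R : realType} {m n : nat} :
  continuous (fun A : 'M[R]_(m, n) => A^T).
Proof.
move=> A U /nbhs_ballP[e /= e0 eU]; apply/nbhs_ballP; exists e => // B [_ AB].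
by apply: eU; split => // i j; rewrite !mxE.
Qed.

Lemma coord_le_norm {R : realType} {m n : nat} (A : 'M[R]_(m, n)) i j : `|A i j| <= `|A|.
Proof.
by rewrite [leRHS]/Num.norm /= mx_normrE; apply/bigmax_geP; right => /=; exists (i, j).
Qed.

Lemma norm_le_coord {R : realType} {m n : nat} (A : 'M[R]_(m, n)) (c : R) : 0 <= c ->
  (forall i j, `|A i j| <= c) -> `|A| <= c.
Proof.
move=> c0 Ac; rewrite [leLHS]/Num.norm /= mx_normrE; by apply/bigmax_leP; split => // -[i j] _.
Qed.

(** Transposition carries the Heine-Borel theorem over from row vectors. *)
Lemma compact_closure_cV {R : realType} {n : nat} (A : set 'cV[R]_n) :
  bounded_set A -> compact (closure A).
Proof.
move=> [M [Mr AM]].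
have AM1 v : A v -> `|v| <= `|M| + 1.
  by apply: AM; rewrite (le_lt_trans (ler_norm M))// ltrDl.
pose K : set 'rV[R]_n := [set v | closure A v^T].
have cK : closed K.
  exact: (preimage_closed (fun v _ => trmx_continuous v) (@closed_closure _ A)).
have AM2 v : closure A v -> `|v| <= `|M| + 1.
  have cN : closed [set v : 'cV[R]_n | `|v| <= `|M| + 1].
    apply: (@preimage_closed _ _ (fun v : 'cV[R]_n => `|v| : R) [set r : R | r <= `|M| + 1]).
      by move=> w _; exact: norm_continuous.
    exact: closed_le.
  by move=> Av; apply: cN; apply: closureS Av => w /AM1.
have M1 : 0 <= `|M| + 1 by rewrite addr_ge0.
have bK : bounded_set K.
  exists (`|M| + 1); split; first exact: num_real.
  move=> c /ltW Mc v /AM2 vM; apply: (le_trans _ Mc); apply: norm_le_coord => // i j.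
  by apply: le_trans vM; have := coord_le_norm v^T j i; rewrite mxE.
have cptK := bounded_closed_compact bK cK.
have -> : closure A = (fun v : 'rV[R]_n => v^T) @` K.
  apply/seteqP; split => [v Av|v [w Kw <-]//].
  by exists v^T; rewrite /K /= ?trmxK.
apply: continuous_compact cptK; apply: continuous_subspaceT; exact: trmx_continuous.
Qed.

Section Bounds.
Context {R : realType} {N p : nat} (P : problem R N p).
Variable (phi : R * 'cV[R]_N -> R).
Hypothesis phis : smooth_on_Qcl P phi.
Hypothesis bO : bounded_set (domain P).
Hypothesis T0 : 0 < horizon P.

Local Notation T := (horizon P).
Local Notation D s := (pderiv s phi).
Local Notation Dcl s := (pderivcl P s phi).

(** Makes the filters defining the closed derivatives proper. *)
Lemma Qcl_closure_Qint : Qcl P `<=` closure (Qint P).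
Proof.
move=> [t x] /QclE [/andP[t0 tT] Ox] A [[A1 A2] /= [At Ax] AA].
have [x' [Ox' Ax']] := Ox _ Ax.
have /nbhs_ballP[e /= e0 eA] := At.
have [t' t'T tt'] : exists2 t', 0 < t' < T & `|t - t'| < e.
  (* Shift by at most half of the room available on the chosen side. *)
  have [tlt|tge] := ltP t T.
    pose r := Num.min (e / 2) ((T - t) / 2).
    have r0 : 0 < r by rewrite lt_min !divr_gt0// subr_gt0.
    have re : r <= e / 2 by rewrite ge_min lexx.
    have rT : r <= (T - t) / 2 by rewrite ge_min lexx orbT.
    exists (t + r); first by apply/andP; split; lra.
    by rewrite opprD addrA subrr sub0r normrN gtr0_norm//; lra.
  pose r := Num.min (e / 2) (T / 2).
  have r0 : 0 < r by rewrite lt_min !divr_gt0.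
  have re : r <= e / 2 by rewrite ge_min lexx.
  have rT : r <= T / 2 by rewrite ge_min lexx orbT.
  exists (t - r); first by apply/andP; split; lra.
  by rewrite opprB addrC subrK gtr0_norm//; lra.
exists (t', x'); split; first exact/QintE.
by apply: AA; split => //=; exact: eA.
Qed.

Lemma compact_Qcl : compact (Qcl P).
Proof. by apply: compact_setX; [exact: segment_compact|exact: compact_closure_cV]. Qed.

(** A bound for the interior derivative near [z] survives in the limits taken
at all neighbouring points of the closed cylinder. *)
Lemma pderivcl_nbhs_bound l z : Qcl P z ->
  exists2 M, 0 <= M & \forall w \near z, Qcl P w -> `|Dcl l w| <= M.
Proof.
move=> Qz; have cz := (phis.2 l).2 _ Qz.
pose L := Dcl l z.
have PF w : Qcl P w -> ProperFilter (within (Qint P) (nbhs w)).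
  by move=> Qw; apply: within_nbhs_proper; exact: Qcl_closure_Qint.
exists (`|L| + 1); first by rewrite addr_ge0.
have h : nbhs z [set w | Qint P w -> `|D l w| <= `|L| + 1].
  have := cz; move=> /cvgrPdist_le /(_ 1 ltr01) h.
  have h' : nbhs z [set t | Qint P t -> `|L - D l t| <= 1] := h.
  apply: filterS h' => w h' Qw; have {}h' := h' Qw.
  have := ler_normD (D l w - L) L; rewrite subrK => /le_trans; apply.
  by rewrite addrC lerD2l distrC.
have := nbhs_interior h; apply: filterS => w hw Qw.
have cw : (D l @ within (Qint P) (nbhs w)) --> Dcl l w := (phis.2 l).2 _ Qw.
have := PF _ Qw => PFw.
apply: (closed_cvg (F := within (Qint P) (nbhs w)) (u_ := fun v => `|D l v|) _
  (@closed_le _ (`|L| + 1)) hw _ _).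
exact: cvg_norm.
Qed.

Lemma pderivcl_bounded l : exists M, forall z, Qcl P z -> `|Dcl l z| <= M.
Proof.
have /compact_near_coveringP/near_covering_withinP cQ := compact_Qcl.
have h : \forall M \near +oo, Qcl P `<=` [set z | `|Dcl l z| <= M].
  apply: cQ => z Qz; have [M M0 zM] := pderivcl_nbhs_bound l z Qz.
  exists ([set w | Qcl P w -> `|Dcl l w| <= M], [set i : R | M <= i]).
    split => //=; apply: nbhs_pinfty_ge; exact: num_real.
  move=> [w i] /= [wM Mi] Qw; exact: le_trans (wM Qw) Mi.
by have [M hM] := filter_ex h; exists M.
Qed.

Lemma fnorm_coord {m n : nat} (A : 'M[R]_(m, n)) i j : `|A i j| <= fnorm A.
Proof.
rewrite -sqrtr_sqr ler_wsqrtr// (bigD1 i)//= (bigD1 j)//= -addrA lerDl addr_ge0//.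
  by apply: sumr_ge0 => k _; rewrite sqr_ge0.
by apply: sumr_ge0 => k _; apply: sumr_ge0 => k' _; rewrite sqr_ge0.
Qed.

Lemma fnorm_le {m n : nat} (A : 'M[R]_(m, n)) (c : 'I_m -> 'I_n -> R) :
  (forall i j, `|A i j| <= c i j) -> fnorm A <= Num.sqrt (\sum_i \sum_j c i j ^+ 2).
Proof.
move=> Ac; apply: ler_wsqrtr; apply: ler_sum => i _; apply: ler_sum => j _.
rewrite -real_normK ?num_real// lerXn2r ?nnegrE//.
exact: le_trans (Ac i j).
Qed.

Lemma supn_ub g (M : R) : (forall z, Qcl P z -> g z <= M) ->
  forall z, Qcl P z -> g z <= supn P g.
Proof.
move=> gM z Qz; apply: ub_le_sup; last by exists z.
by exists M => _ [w Qw <-]; exact: gM.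
Qed.

Lemma supn_ge0 g : (forall z, 0 <= g z) -> 0 <= supn P g.
Proof.
move=> g0; rewrite /supn; have [hs|/sup_out->//] := pselect (has_sup [set g z | z in Qcl P]).
have [[_ [z Qz _]] hu] := hs.
by apply: le_trans (g0 z) _; apply: ub_le_sup => //; exists z.
Qed.

End Bounds.

(** * Interpolation error *)

Section Interp.
Context {R : realType} {N : nat} (m : mesh R N).
Hypothesis basis : P1_nodal_basis m.

Lemma hull_vertex (e : {set 'I_(nvert m)}) i : i \in e -> hull e (vert m i).
Proof.
move=> ie; exists (fun k => (k == i)%:R); split => [k|k ke||].
- by rewrite ler0n.
- by case: eqP => // ki; move: ke; rewrite ki ie.
- by rewrite (bigD1 i)//= eqxx big1 ?addr0 // => k /negPf ->.
- by rewrite (bigD1 i)//= eqxx scale1r big1 ?addr0 // => k /negPf ->; rewrite scale0r.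
Qed.

Lemma dotp_sum (g : 'cV[R]_N) (l : 'I_(nvert m) -> R) :
  dotp g (\sum_i l i *: vert m i) = \sum_i l i * dotp g (vert m i).
Proof.
rewrite /dotp; under eq_bigr do rewrite summxE mulr_sumr.
rewrite exchange_big /=; apply: eq_bigr => i _; rewrite mulr_sumr.
by apply: eq_bigr => j _; rewrite mxE mulrCA.
Qed.

(** An affine function on a simplex is determined by its values at the
vertices, which are 0 and 1 here. *)
Lemma psi_barycentric e (l : 'I_(nvert m) -> R) k : e \in elems m ->
  (forall i, 0 <= l i) -> (forall i, i \notin e -> l i = 0) -> \sum_i l i = 1 ->
  psi m k (\sum_i l i *: vert m i) = l k.
Proof.
move=> eE l0 le l1; have [_ aff delta] := basis.
have [g [b gb]] := aff k e eE.
rewrite gb; last by exists l.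
rewrite dotp_sum -[b]mul1r -l1 mulr_suml -big_split /= (bigD1 k)//= big1 ?addr0.
  have [ke|ke] := boolP (k \in e); last by rewrite le// !mul0r addr0.
  by rewrite -mulrDr -gb ?delta ?eqxx ?mulr1//; exact: hull_vertex.
move=> i ik; have [ie|ie] := boolP (i \in e); last by rewrite le// !mul0r addr0.
by rewrite -mulrDr -gb ?delta 1?eq_sym ?(negPf ik) ?mulr0//; exact: hull_vertex.
Qed.

Lemma psi_partition y : Ohbar m y ->
  [/\ forall k, 0 <= psi m k y, \sum_k psi m k y = 1 &
      \sum_k psi m k y *: vert m k = y].
Proof.
move=> [e /= eE [l [l0 le l1 ->]]].
have E k := psi_barycentric e l k eE l0 le l1.
split => [k||]; first by rewrite E.
  by under eq_bigr do rewrite E.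
by apply: eq_bigr => k _; rewrite E.
Qed.

Lemma interp_vertex (Phi : 'I_(nvert m) -> R) l : Defs.proj m (vert m l) = vert m l ->
  interp Phi (vert m l) = Phi l.
Proof.
move=> pl; have [_ _ delta] := basis; rewrite /interp pl (bigD1 l)//= delta eqxx mul1r.
by rewrite big1 ?addr0// => i il; rewrite delta (negPf il) mul0r.
Qed.

Section Error.
Context {p : nat} (P : problem R N p).
Variable (phi : R * 'cV[R]_N -> R).
Hypothesis phis : smooth_on_Qcl P phi.
Hypothesis openO : open (domain P).
Local Notation D s := (pderiv s phi).
Local Notation Dcl s := (pderivcl P s phi).
Local Notation T := (horizon P).
Local Notation O := (domain P).
Local Notation n := (N%:R : R).
Variables M1 M2 : R.
Hypothesis M10 : 0 <= M1.
Hypothesis M20 : 0 <= M2.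
Hypothesis DM1 : forall i z, Qcl P z -> `|Dcl [:: Some i] z| <= M1.
Hypothesis DM2 : forall i k z, Qcl P z -> `|Dcl [:: Some k; Some i] z| <= M2.

(** The gradient terms do not sum to zero but to the gradient applied to
[p_h x - x], which has order [h ^+ 2] by itself. *)
Lemma interp_error (Cp Cpatch h t : R) (x : 'cV[R]_N) : 0 < t <= T -> O x ->
  Ohbar m (Defs.proj m x) -> fnorm (Defs.proj m x - x) <= Cp * h ^+ 2 ->
  (forall l, 0 < psi m l (Defs.proj m x) ->
    fnorm (vert m l - x) <= Cpatch * h /\
    forall s : R, 0 <= s < 1 -> O ((1 - s) *: x + s *: vert m l)) ->
  `|interp (fun l => phi (t, vert m l)) x - phi (t, x)|
    <= (n * `|Cp| + n * n * Cpatch ^+ 2) * (h ^+ 2 * (M1 + M2)).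
Proof.
move=> tT Ox px pxx seg.
have [psi0 psi1 psix] := psi_partition _ px.
have QM l z : Qint P z -> D l z = Dcl l z by move=> Qz; rewrite pderivclE.
have Qz : Qcl P (t, x).
  by apply/QclE; split; [case/andP: tT => /ltW -> ->|exact: subset_closure].
set B := `|Cpatch * h|.
set w := fun l => psi m l (Defs.proj m x).
set G := fun i => Dcl [:: Some i] (t, x).
have segl l : `|w l * (phi (t, vert m l) - phi (t, x) - \sum_i (vert m l - x) i 0 * G i)|
    <= w l * (n * (B * (n * (B * M2)))).
  rewrite normrM ger0_norm ?psi0//.
  have [->|wl] := eqVneq (w l) 0; first by rewrite !mul0r.
  have wl0 : 0 < w l by rewrite lt_def wl psi0.
  rewrite ler_pM2l//; have [lx lO] := seg l wl0.
  have xl : x + (vert m l - x) = vert m l by rewrite addrC subrK.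
  rewrite -{1}xl.
  apply: (segment_closure P phi phis M1 M2) => //.
  - by move=> i z Qi; rewrite QM ?DM1//; exact: Qint_Qcl.
  - by move=> i k z Qi; rewrite QM ?DM2//; exact: Qint_Qcl.
  - exact: normr_ge0.
  - move=> i; apply: (le_trans (fnorm_coord _ _ _)); apply: (le_trans lx); exact: ler_norm.
  - move=> u u01; have := lO u u01; congr O.
    by rewrite scalerBl scale1r scalerBr addrAC addrA.
have -> : interp (fun l => phi (t, vert m l)) x - phi (t, x) =
  \sum_l w l * (phi (t, vert m l) - phi (t, x) - \sum_i (vert m l - x) i 0 * G i)
  + \sum_i (Defs.proj m x - x) i 0 * G i.
  have -> : \sum_i (Defs.proj m x - x) i 0 * G i = \sum_l w l * \sum_i (vert m l - x) i 0 * G i.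
    have -> : Defs.proj m x - x = \sum_l w l *: (vert m l - x).
      under [RHS]eq_bigr do rewrite scalerBr.
      by rewrite sumrB -scaler_suml psi1 scale1r psix.
    under eq_bigr do rewrite summxE mulr_suml.
    rewrite exchange_big; apply: eq_bigr => l _; rewrite mulr_sumr; apply: eq_bigr => i _.
    by rewrite [in LHS]mxE mulrA.
  rewrite -big_split /= /interp -[phi (t, x) in LHS]mul1r -[X in _ - X * _]psi1 mulr_suml -sumrB.
  by apply: eq_bigr => l _; rewrite -/(w l); ring.
apply: le_trans (ler_normD _ _) _.
have -> : (n * `|Cp| + n * n * Cpatch ^+ 2) * (h ^+ 2 * (M1 + M2)) =
  n * (B * (n * (B * M2))) + n * (`|Cp| * h ^+ 2 * M1)
  + ((n * `|Cp|) * (h ^+ 2 * M2) + (n * n * Cpatch ^+ 2) * (h ^+ 2 * M1)).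
  have BB : B * B = Cpatch ^+ 2 * h ^+ 2 by rewrite -normrM -expr2 ger0_norm ?sqr_ge0// exprMn.
  rewrite [n * (B * (n * (B * M2)))](_ : _ = n * n * (B * B) * M2); last by ring.
  by rewrite BB; ring.
have h20 : 0 <= h ^+ 2 by exact: sqr_ge0.
apply: ler_wpDr.
  have C20 : 0 <= Cpatch ^+ 2 by exact: sqr_ge0.
  by nonneg.
apply: lerD.
  apply: le_trans (ler_norm_sum _ _ _) _; apply: le_trans (ler_sum _ (fun l _ => segl l)) _.
  by rewrite -mulr_suml psi1 mul1r.
apply: norm_sum_le_const => i; rewrite normrM ler_pM ?DM1//.
apply: (le_trans (fnorm_coord _ _ _)); apply: (le_trans pxx).
by rewrite ler_wpM2r// ler_norm.
Qed.

End Error.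
End Interp.

(** * Stopped branches and moments of the weights *)

Lemma fnorm_ge0 {R : realType} {m n : nat} (A : 'M[R]_(m, n)) : 0 <= fnorm A.
Proof. exact: sqrtr_ge0. Qed.

Lemma esup_ge {R : realType} {T : Type} (D : set T) (g : T -> R) z : D z ->
  ((g z)%:E <= esup D g)%E.
Proof. by move=> Dz; apply: ereal_sup_ubound; exists z. Qed.

Lemma coef_bounds {R : realType} {N p : nat} (P : problem R N p) (K0 : R) :
  problem_ok P K0 -> forall z a, Qcl P z ->
  [/\ fnorm (sigma P z.1 z.2 a) <= K0, fnorm (mu P z.1 z.2 a) <= K0,
      `|rate P z.1 z.2 a| <= K0 & `|cost P z.1 z.2 a| <= K0].
Proof.
move=> [_ _ _ _ [supK _ _ _]] z a Qz.
have := le_trans (ereal_sup_ubound _) supK.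
move=> /(_ (_ : \bar R) (ex_intro2 _ _ a I erefl)).
set S1 := esup _ _; set S2 := esup _ _; set S3 := esup _ _; set S4 := esup _ _ => SK.
have h1 : ((fnorm (sigma P z.1 z.2 a))%:E <= S1)%E by exact: (esup_ge _ (fun z => fnorm (sigma P z.1 z.2 a))).
have h2 : ((fnorm (mu P z.1 z.2 a))%:E <= S2)%E by exact: (esup_ge _ (fun z => fnorm (mu P z.1 z.2 a))).
have h3 : (`|rate P z.1 z.2 a|%:E <= S3)%E by exact: (esup_ge _ (fun z => `|rate P z.1 z.2 a|)).
have h4 : (`|cost P z.1 z.2 a|%:E <= S4)%E by exact: (esup_ge _ (fun z => `|cost P z.1 z.2 a|)).
have {}SK : ((fnorm (sigma P z.1 z.2 a) + fnorm (mu P z.1 z.2 a)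
    + `|rate P z.1 z.2 a| + `|cost P z.1 z.2 a|)%:E <= K0%:E)%E.
  by apply: le_trans SK; rewrite !EFinD !leeD.
move: SK; rewrite lee_fin.
have := fnorm_ge0 (sigma P z.1 z.2 a); have := fnorm_ge0 (mu P z.1 z.2 a).
have := normr_ge0 (rate P z.1 z.2 a); have := normr_ge0 (cost P z.1 z.2 a).
by split; lra.
Qed.

Section Node.
Context {R : realType} {N p : nat} (P : problem R N p) (c : cubature R p) (m : mesh R N).
Variables (Nt n : nat) (i : 'I_(nvert m)) (a : ctrl P).
Hypothesis openO : open (domain P).
Hypothesis Oi : domain P (vert m i).
Hypothesis dt0 : 0 < timestep P Nt.
Hypothesis cub : cubature_ok c.

Local Notation O := (domain P).
Local Notation Dt := (timestep P Nt).
Local Notation tn := (tgrid P Nt n).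
Local Notation xi := (vert m i).
Local Notation dur := (dur (c := c) Nt n i a).
Local Notation sdur := (sdur (c := c) Nt n i a).
Local Notation exits := (exits (c := c) Nt n i a).
Local Notation branch := (branch (c := c) Nt n i a).
Local Notation exit_times := (exit_times (c := c) Nt n i a).
Local Notation omega := (omega (c := c) Nt n i a).
Local Notation tau := (tau c Nt n i a).
Local Notation theta := (theta (c := c) Nt n i a).

Definition branch_vec (j : 'I_(npts c)) (b : bool) : 'cV[R]_N :=
  sgn R b *: (sigma P tn xi a *m Defs.eta c j).

Lemma branchE j b s : 0 <= s ->
  branch j b (s ^+ 2) = xi + s *: branch_vec j b + s ^+ 2 *: mu P tn xi a.
Proof.
by move=> s0; rewrite /branch sqrtr_sqr ger0_norm// /branch_vec scalerA [s * _]mulrC addrAC.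
Qed.

(** The node is an interior point of the open domain, so a branch needs a
positive time to leave it. *)
Lemma exit_times_lb j b : exists2 e : R, 0 < e & lbound (exit_times j b) e.
Proof.
pose g := qcurve 0 0 xi (branch_vec j b) (mu P tn xi a).
have nO : nbhs (g 0) (fun z : R * 'cV[R]_N => O z.2).
  have c2 : (fun z : R * 'cV[R]_N => z.2) @ g 0 --> (g 0).2 by exact: cvg_snd.
  by apply: c2; rewrite /g qcurve0 /=; apply: open_nbhs_nbhs.
have /nbhs_ballP[e /= e0 eO] := continuous_qcurve 0 0 xi (branch_vec j b) (mu P tn xi a) 0 _ nO.
exists (e ^+ 2); first exact: exprn_gt0.
move=> q [/andP[q0 _] nq]; rewrite leNgt; apply/negP => qe; apply: nq.
have s0 := sqrtr_ge0 q.
have E : q = Num.sqrt q ^+ 2 by rewrite sqr_sqrtr// ltW.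
rewrite E branchE//; apply: (eO (Num.sqrt q)).
rewrite /ball /= sub0r normrN ger0_norm//.
rewrite ltNge; apply/negP => es; move: qe; rewrite ltNge => /negP; apply.
by rewrite E lerXn2r ?nnegrE// ltW.
Qed.

Lemma dur_gt0 j b : 0 < dur j b.
Proof.
rewrite /Defs.dur; case: ifP => // /asboolP ex.
have [e e0 el] := exit_times_lb j b.
exact: lt_le_trans e0 (lb_le_inf ex el).
Qed.

Lemma dur_le j b : dur j b <= Dt.
Proof.
rewrite /Defs.dur; case: ifP => // /asboolP [q eq].
have [e e0 el] := exit_times_lb j b.
apply: (@le_trans _ _ q); last by case: eq => /andP[].
by apply: ge_inf => //; exists e.
Qed.

Lemma branch_in j b q : 0 < q < dur j b -> O (branch j b q).
Proof.
move=> /andP[q0 qd]; apply: contrapT => nO.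
have eq : exit_times j b q by split => //; rewrite q0 (le_trans (ltW qd))//; exact: dur_le.
have ex : exits j b by apply/asboolP; exists q.
have [e e0 el] := exit_times_lb j b.
move: qd; rewrite /Defs.dur ex ltNge => /negP; apply.
by apply: ge_inf => //; exists e.
Qed.

Lemma noexit_dur j b : ~~ exits j b -> dur j b = Dt.
Proof. by rewrite /Defs.dur => /negPf ->. Qed.

Lemma noexit_in j b : ~~ exits j b -> O (branch j b Dt).
Proof.
move=> nex; apply: contrapT => nO; move/negP: nex; apply; apply/asboolP.
by exists Dt; split => //; rewrite dt0 lexx.
Qed.

Lemma sdur_gt0 j b : 0 < sdur j b.
Proof. by rewrite sqrtr_gt0 dur_gt0. Qed.

Lemma sdur_sqr j b : sdur j b ^+ 2 = dur j b.
Proof. by rewrite sqr_sqrtr// ltW// dur_gt0. Qed.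

Lemma theta_gt0 j : 0 < theta j.
Proof. by rewrite mulr_gt0 ?sdur_gt0. Qed.

Lemma tau_gt0 : 0 < tau.
Proof.
have [M1 _ rho0 _ _] := cub.
rewrite invr_gt0 (bigD1 (Ordinal M1))//= ltr_pwDl//.
  by rewrite divr_gt0 ?theta_gt0.
by apply: sumr_ge0 => j _; rewrite ltW// divr_gt0 ?theta_gt0.
Qed.

Lemma omega_gt0 j b : 0 < omega j b.
Proof.
have [_ _ rho0 _ _] := cub.
by rewrite divr_gt0 ?mulr_gt0 ?tau_gt0 ?addr_gt0 ?sdur_gt0.
Qed.

Lemma omega_mass : \sum_j \sum_(b : bool) omega j b = 1.
Proof.
have E j : \sum_(b : bool) omega j b = tau * (rho c j / theta j).
  rewrite big_bool /= /Defs.omega /Defs.theta.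
  have := sdur_gt0 j true; have := sdur_gt0 j false.
  set u := Defs.sdur _ _ _ _ _ true; set v := Defs.sdur _ _ _ _ _ false => v0 u0.
  by field; rewrite !gt_eqF// addr_gt0.
under eq_bigr do rewrite E.
rewrite -mulr_sumr /Defs.tau mulVf//.
by have := tau_gt0; rewrite invr_gt0 => /gt_eqF ->.
Qed.

Lemma omega_first j : \sum_(b : bool) omega j b * (sgn R b * sdur j b) = 0.
Proof.
rewrite big_bool /= /Defs.omega /sgn.
have := sdur_gt0 j true; have := sdur_gt0 j false.
set u := Defs.sdur _ _ _ _ _ true; set v := Defs.sdur _ _ _ _ _ false => v0 u0.
by field; rewrite !gt_eqF// addr_gt0.
Qed.

Lemma omega_second j : \sum_(b : bool) omega j b * dur j b = tau * rho c j.
Proof.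
rewrite big_bool /= /Defs.omega -!sdur_sqr.
have := sdur_gt0 j true; have := sdur_gt0 j false.
set u := Defs.sdur _ _ _ _ _ true; set v := Defs.sdur _ _ _ _ _ false => v0 u0.
by field; rewrite !gt_eqF// addr_gt0.
Qed.

(** Mass 1, vanishing first moment and second moment [tau * rho j] are all
that the consistency of the scheme uses of the weights. *)
Lemma omega_average (X : 'I_(npts c) -> bool -> R) (x0 : R) (beta kappa : 'I_(npts c) -> R)
    (E : R) :
  (forall j b, `|X j b - x0 - (sgn R b * sdur j b * beta j + dur j b * kappa j)|
     <= dur j b * E) ->
  exists rem, \sum_j \sum_(b : bool) omega j b * X j b - x0
     = tau * (\sum_j rho c j * kappa j) + rem /\ `|rem| <= tau * E.
Proof.
move=> XE; have [_ _ rho0 rho1 _] := cub.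
pose er j b := X j b - x0 - (sgn R b * sdur j b * beta j + dur j b * kappa j).
exists (\sum_j \sum_(b : bool) omega j b * er j b); split.
  rewrite -[x0 in LHS]mul1r -omega_mass mulr_suml -sumrB mulr_sumr -big_split /=.
  apply: eq_bigr => j _.
  rewrite mulr_suml -sumrB mulrA -omega_second mulr_suml -big_split /=.
  have Z : 0 = \sum_(b : bool) omega j b * (sgn R b * sdur j b) * beta j.
    by rewrite -mulr_suml omega_first mul0r.
  rewrite -[LHS]subr0 [X in _ - X = _]Z -sumrB.
  by apply: eq_bigr => b _; rewrite /er; ring.
apply: le_trans (ler_norm_sum _ _ _) _.
rewrite -[tau * E]mulr1 -rho1 mulr_sumr; apply: ler_sum => j _.
rewrite mulrAC -omega_second mulr_suml; apply: le_trans (ler_norm_sum _ _ _) _.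
apply: ler_sum => b _; rewrite normrM (gtr0_norm (omega_gt0 _ _)) -[leRHS]mulrA.
rewrite ler_pM2l ?omega_gt0//.
exact: XE.
Qed.

End Node.

(** * Expansion of the branches and consistency *)

Lemma mulmx_coord_bound {R : realType} {N p : nat} (S : 'M[R]_(N, p)) (v : 'cV[R]_p) (K : R) i :
  fnorm S <= K -> `|(S *m v) i 0| <= p%:R * (K * fnorm v).
Proof.
move=> SK; rewrite mxE; apply: norm_sum_le_const => k; rewrite normrM ler_pM//.
  exact: le_trans (fnorm_coord _ _ _) SK.
exact: fnorm_coord.
Qed.

(** Here [v] is the interpolated and [w] the exact value at the end of the
branch.  Expanding the discount factor to first order replaces [w] by [x0] in
the term [r d w]; the second-order term needs only the size of [w]. *)
Lemma discount_error {R : realType} (v w x0 l r f d K E1 E2 E3 M0 : R) :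
  0 <= r -> 0 <= d -> r <= K ->
  `|v - w| <= E1 -> `|w - x0 - l| <= E2 -> `|w - x0| <= E3 -> `|w| <= M0 ->
  `|v / (1 + r * d) + f * d - x0 - (l + d * (f - r * x0))|
   <= E1 + E2 + K * d * E3 + (K * d) ^+ 2 * M0.
Proof.
move=> r0 d0 rK H1 H2 H3 H4.
have rd0 : 0 <= r * d by exact: mulr_ge0.
have rd1 : 1 <= 1 + r * d by rewrite lerDl.
have rdp : 0 < 1 + r * d by exact: lt_le_trans rd1.
have rdK : r * d <= K * d by rewrite ler_wpM2r.
have divle y M : `|y| <= M -> `|y / (1 + r * d)| <= M.
  move=> yM; rewrite normrM normfV (gtr0_norm rdp) ler_pdivrMr//.
  by apply: (le_trans yM); rewrite ler_peMr// (le_trans _ yM).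
have -> : v / (1 + r * d) + f * d - x0 - (l + d * (f - r * x0)) =
  (v - w) / (1 + r * d) + (w - x0 - l) + - (r * d * (w - x0)) + (r * d) ^+ 2 * w / (1 + r * d).
  by field; rewrite gt_eqF.
apply: le_trans (ler_normD _ _) _; apply: lerD; last first.
  apply: divle; rewrite normrM ger0_norm ?sqr_ge0//.
  by apply: ler_pM => //; rewrite ?sqr_ge0// lerXn2r ?nnegrE// (le_trans rd0).
apply: le_trans (ler_normD _ _) _; apply: lerD; last first.
  by rewrite normrN normrM ger0_norm//; apply: ler_pM.
apply: le_trans (ler_normD _ _) _; apply: lerD => //.
exact: divle.
Qed.

Section Branch.
Context {R : realType} {N p : nat} (P : problem R N p) (c : cubature R p) (m : mesh R N).
Variables (K0 Cbd Cp Cpatch : R).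
Hypothesis Pok : problem_ok P K0.
Hypothesis cub : cubature_ok c.
Variables (Nt n : nat) (i : 'I_(nvert m)) (a : ctrl P).
Hypothesis Nt0 : (0 < Nt)%N.
Hypothesis dt1 : timestep P Nt <= 1.
Hypothesis mok : mesh_ok P c m Cbd Cp Cpatch Nt.
Hypothesis nNt : (n < Nt)%N.
Hypothesis Oi : domain P (vert m i).
Variable (phi : R * 'cV[R]_N -> R).
Hypothesis phis : smooth_on_Qcl P phi.

Local Notation Dcl s := (pderivcl P s phi).
Local Notation T := (horizon P).
Local Notation O := (domain P).
Local Notation nn := (N%:R : R).
Local Notation Dt := (timestep P Nt).
Local Notation h := (mesh_size m).
Local Notation tn := (tgrid P Nt n).
Local Notation xi := (vert m i).
Local Notation dur := (dur (c := c) Nt n i a).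
Local Notation sdur := (sdur (c := c) Nt n i a).
Local Notation exits := (exits (c := c) Nt n i a).
Local Notation branch := (branch (c := c) Nt n i a).

Variables M0 M1 M2 M3 Mt Mtt Mtd : R.
Hypothesis DM0 : forall z, Qcl P z -> `|phi z| <= M0.
Hypothesis DM1 : forall i z, Qcl P z -> `|Dcl [:: Some i] z| <= M1.
Hypothesis DM2 : forall i k z, Qcl P z -> `|Dcl [:: Some k; Some i] z| <= M2.
Hypothesis DM3 : forall i k j z, Qcl P z ->
  `|Dcl [:: Some j; Some k; Some i] z| <= M3.
Hypothesis DMt : forall z, Qcl P z -> `|Dcl [:: None] z| <= Mt.
Hypothesis DMtt : forall z, Qcl P z -> `|Dcl [:: None; None] z| <= Mtt.
Hypothesis DMtd : forall i z, Qcl P z -> `|Dcl [:: Some i; None] z| <= Mtd.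
Hypothesis M00 : 0 <= M0.
Hypothesis M10 : 0 <= M1.
Hypothesis M20 : 0 <= M2.
Hypothesis M30 : 0 <= M3.
Hypothesis Mt0 : 0 <= Mt.
Hypothesis Mtt0 : 0 <= Mtt.
Hypothesis Mtd0 : 0 <= Mtd.

Let openO : open O. Proof. by case: Pok => _ []. Qed.
Let T0 : 0 < T. Proof. by case: Pok. Qed.
Let K00 : 0 <= K0. Proof. by case: Pok => _ _ _ /ltW. Qed.

Lemma Dt_gt0 : 0 < Dt.
Proof. by rewrite divr_gt0// ltr0n. Qed.

Lemma tgridS : tgrid P Nt n.+1 = tn + Dt.
Proof. by rewrite /tgrid -natr1 mulrDl mul1r. Qed.

Lemma tgrid_ge0 : 0 <= tn.
Proof. by rewrite mulr_ge0// ltW// Dt_gt0. Qed.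

Lemma tgridS_le : tn + Dt <= T.
Proof.
rewrite -tgridS /tgrid /timestep mulrA ler_pdivrMr ?ltr0n// mulrC.
by rewrite ler_pM2l// ler_nat.
Qed.

Lemma Qcl_node : Qcl P (tn, xi).
Proof.
apply/QclE; split; last exact: subset_closure.
by rewrite tgrid_ge0 (le_trans _ tgridS_le)// lerDl ltW// Dt_gt0.
Qed.

Let B := p%:R * (K0 * \sum_j fnorm (Defs.eta c j)).
Let L := B + 2 * K0.
Let cI := nn * `|Cp| + nn * nn * Cpatch ^+ 2.
Let c2 := nn * (B * (nn * (2 * K0))) + nn * (2 * K0 * (nn * L)).
Let c3 := nn * (B * (nn * (B * (nn * L)))).

(** Sum of the constants of the individual estimates, a crude common bound. *)
Definition branch_constant : R :=
  K0 * (nn * L) + c2 + c3 + nn * L + 1 + K0 ^+ 2 + K0 + cI.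

Definition error_bound : R :=
  Num.sqrt Dt * (M1 + M2 + M3 + Mtd) + Dt * (M0 + Mt + M2 + Mtt)
  + h ^+ 2 / Dt * (M1 + M2).

Let cI0 : 0 <= cI.
Proof. by have C20 := sqr_ge0 Cpatch; rewrite /cI; nonneg. Qed.

Lemma interp_branch j b : ~~ exits j b ->
  `|branch_value Nt n i a phi j b - phi (tn + dur j b, branch j b (dur j b))|
   <= dur j b * (cI * (h ^+ 2 / Dt * (M1 + M2))).
Proof.
move=> nex; have Dt0 := Dt_gt0.
rewrite /branch_value (negPf nex) noexit_dur//.
have Ox := noexit_in P c m Nt n i a Dt0 j b nex.
set x := Defs.branch _ _ _ _ _ _ _ in Ox *.
have -> : Dt * (cI * (h ^+ 2 / Dt * (M1 + M2))) = cI * (h ^+ 2 * (M1 + M2)).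
  by field; rewrite gt_eqF.
rewrite -tgridS; have tS : 0 < tgrid P Nt n.+1 <= T.
  by rewrite tgridS tgridS_le andbT ltr_wpDl// tgrid_ge0.
have [_ _ _ [_ g4a g4b g4c g4d] bas] := mok.
have [[l _ lx]|nx] := pselect (range (vert m) x).
  rewrite -lx interp_vertex// subrr normr0.
  by have h20 := sqr_ge0 h; nonneg.
apply: (interp_error m bas P phi phis openO M1 M2) => //.
- by apply: g4a; exact: subset_closure.
- by apply: g4c; exact: subset_closure.
- move=> l pl; have off : offgrid_endpoints P c m Nt x by exists n, i, a, j, b; split.
  by have [? _ ?] := g4d _ l off pl.
Qed.

Definition drift (j : 'I_(npts c)) : R :=
  Dcl [:: None] (tn, xi)
  + quad_part (sigma P tn xi a *m Defs.eta c j) (mu P tn xi a) (fun l => Dcl l (tn, xi))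
  + (cost P tn xi a - rate P tn xi a * phi (tn, xi)).

Definition noise (j : 'I_(npts c)) : R :=
  \sum_k (sigma P tn xi a *m Defs.eta c j) k 0 * Dcl [:: Some k] (tn, xi).

(** Each error term carries a factor [d] because [s ^+ 3 = d * s] and
[d ^+ 2 <= d * Delta t]; the remaining powers are absorbed in the bracket. *)
Lemma branch_error j b :
  `|branch_value Nt n i a phi j b / (1 + rate P tn xi a * dur j b)
    + cost P tn xi a * dur j b - phi (tn, xi)
    - (sgn R b * sdur j b * noise j + dur j b * drift j)|
   <= dur j b * (branch_constant * error_bound).
Proof.
have Dt0 := Dt_gt0.
have [sK mK rK fK] := coef_bounds P K0 Pok (tn, xi) a Qcl_node.
have r0 : 0 <= rate P tn xi a by have [_ _ _ _ [_ _ _]] := Pok; apply; exact: Qcl_node.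
have {}rK : rate P tn xi a <= K0 by apply: le_trans rK; exact: ler_norm.
have d0 : 0 < dur j b by exact: dur_gt0.
have dD : dur j b <= Dt by exact: dur_le.
have s0 : 0 < sdur j b by exact: sdur_gt0.
have s2 : sdur j b ^+ 2 = dur j b by exact: sdur_sqr.
have sD : sdur j b <= Num.sqrt Dt by exact: ler_wsqrtr.
have s1 : sdur j b <= 1.
  by apply: (le_trans sD); rewrite -[leRHS]sqrtr1 ler_wsqrtr.
set bv := branch_vec P c m Nt n i a j b.
set mv := mu P tn xi a.
have bE s : 0 <= s -> branch j b (s ^+ 2) = xi + s *: bv + s ^+ 2 *: mv.
  by move=> ?; exact: branchE.
have Oy s : 0 <= s < sdur j b -> O (xi + s *: bv + s ^+ 2 *: mv).
  move=> /andP[]; rewrite le_eqVlt => /predU1P[<- _|s00 ss].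
    by rewrite expr0n /= !scale0r !addr0.
  rewrite -(bE _ (ltW s00)); apply: branch_in => //.
  by rewrite exprn_gt0//= -s2 ltrXn2r// ?nnegrE// ltW.
have B0 : 0 <= B by rewrite !mulr_ge0// sumr_ge0// => k _; exact: fnorm_ge0.
have bB k : `|bv k 0| <= B.
  rewrite /bv /branch_vec mxE normrM.
  have -> : `|sgn R b| = 1 by case: (b); rewrite /sgn ?normrN normr1.
  rewrite mul1r; apply: le_trans (mulmx_coord_bound _ _ _ _ sK) _.
  rewrite ler_wpM2l// ler_wpM2l// (bigD1 j)//= lerDl sumr_ge0// => l _; exact: fnorm_ge0.
have mB k : `|mv k 0| <= K0 by apply: le_trans mK; exact: fnorm_coord.
have QM l z : Qint P z -> pderiv l phi z = Dcl l z by move=> Qz; rewrite pderivclE.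
have [] := branch_closure P phi phis M1 M2 M3 Mt Mtt Mtd M10 M20 M30 Mtt0 Mtd0
  _ _ _ _ _ _ B K0 xi bv mv B0 K00 bB mB tn (dur j b) (sdur j b) tgrid_ge0 d0 _ _ Oy.
- by move=> k z Qz; rewrite QM// DM1//; exact: Qint_Qcl.
- by move=> k l z Qz; rewrite QM// DM2//; exact: Qint_Qcl.
- by move=> k l o z Qz; rewrite QM// DM3//; exact: Qint_Qcl.
- by move=> z Qz; rewrite QM// DMt//; exact: Qint_Qcl.
- by move=> z Qz; rewrite QM// DMtt//; exact: Qint_Qcl.
- by move=> k z Qz; rewrite QM// DMtd//; exact: Qint_Qcl.
- by apply: le_trans tgridS_le; rewrite lerD2l.
- by rewrite s0.
rewrite /= -(bE _ (ltW s0)) s2.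
set w := phi (tn + dur j b, _) => H2 H3.
have wM : `|w| <= M0.
  apply: DM0; apply/QclE; split.
    apply/andP; split; first by apply: addr_ge0; [exact: tgrid_ge0|exact: ltW].
    by apply: le_trans tgridS_le; rewrite lerD2l.
  rewrite -s2 (bE _ (ltW s0)).
  exact: (closure_path P _ _ _ _ s0 Oy).
have H1 : `|branch_value Nt n i a phi j b - w| <= dur j b * (cI * (h ^+ 2 / Dt * (M1 + M2))).
  have [ex|nex] := boolP (exits j b); last exact: interp_branch.
  rewrite /branch_value ex subrr normr0.
  have h20 : 0 <= h ^+ 2 / Dt by rewrite divr_ge0 ?sqr_ge0// ltW.
  by have d00 := ltW d0; nonneg.
have := discount_error _ _ _ _ _ (cost P tn xi a) _ _ _ _ _ _ r0 (ltW d0) rK H1 H2 H3 wM.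
have quadE : quad_part bv mv (fun l => Dcl l (tn, xi)) =
   quad_part (sigma P tn xi a *m Defs.eta c j) mv (fun l => Dcl l (tn, xi)).
  congr (_ + 2^-1 * _); apply: eq_bigr => k _; rewrite mxE.
  under eq_bigr do rewrite mxE -mulrA.
  rewrite -mulr_sumr mulrA [sgn R b * _ * _]mulrAC.
  have -> : sgn R b * sgn R b = 1 by case: (b); rewrite /sgn ?mulrNN mulr1.
  by rewrite mul1r.
have noiseE : \sum_k bv k 0 * Dcl [:: Some k] (tn, xi) = sgn R b * noise j.
  by rewrite mulr_sumr; apply: eq_bigr => k _; rewrite mxE mulrA.
rewrite quadE noiseE /drift.
set V := branch_value _ _ _ _ _ _ _; set q := quad_part _ _ _; set pt := Dcl [:: None] _.
have -> : V / (1 + rate P tn xi a * dur j b) + cost P tn xi a * dur j b - phi (tn, xi)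
  - (sdur j b * (sgn R b * noise j) + dur j b * q + dur j b * pt +
     dur j b * (cost P tn xi a - rate P tn xi a * phi (tn, xi))) =
  V / (1 + rate P tn xi a * dur j b) + cost P tn xi a * dur j b - phi (tn, xi)
  - (sgn R b * sdur j b * noise j + dur j b * (pt + q + (cost P tn xi a - rate P tn xi a * phi (tn, xi)))).
  by ring.
move/le_trans; apply.
rewrite -/L (exprS (sdur j b) 2) s2.
have L0 : 0 <= L by rewrite addr_ge0// mulr_ge0.
set d := dur j b in d0 dD *; set s := sdur j b in s0 sD *.
set S := Num.sqrt Dt in sD *.
have c20 : 0 <= c2 by rewrite /c2; nonneg.
have c30 : 0 <= c3 by rewrite /c3; nonneg.
have S0 : 0 <= S by exact: sqrtr_ge0.
have H0 : 0 <= h ^+ 2 / Dt by rewrite divr_ge0 ?sqr_ge0// ltW.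
set H := h ^+ 2 / Dt in H0 *.
(* Replace the remaining powers of s by sqrt Dt and of d by Dt. *)
apply: (@le_trans _ _ (d * (S * (K0 * (nn * L) * M1 + c2 * M2 + c3 * M3 + nn * L * Mtd)
   + Dt * (Mtt + K0 ^+ 2 * M0 + K0 * Mt) + H * (cI * (M1 + M2))))).
  have -> : nn * (B * (nn * (B * (nn * (L * M3))) + nn * (2 * K0 * M2))) +
    nn * (2 * K0 * (nn * (L * M2))) = c2 * M2 + c3 * M3 by rewrite /c2 /c3; ring.
  rewrite -subr_ge0.
  set X := (X in 0 <= X).
  have -> : X = d * (S - s) * (K0 * (nn * L) * M1 + c2 * M2 + c3 * M3 + nn * L * Mtd)
    + d * (Dt - d) * (Mtt + K0 ^+ 2 * M0 + K0 * Mt).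
    by rewrite /X; ring.
  have d00 := ltW d0; have e1 : 0 <= S - s by rewrite subr_ge0.
  have e2 : 0 <= Dt - d by rewrite subr_ge0.
  by nonneg.
(* Each norm is multiplied by at most one summand of the constant, so the
   difference is a sum of nonnegative terms. *)
rewrite ler_pM2l// /error_bound /branch_constant -/S -/H -subr_ge0.
set X := (X in 0 <= X).
have -> : X = S * ((c2 + c3 + nn * L + 1 + K0 ^+ 2 + K0 + cI) * M1
    + (K0 * (nn * L) + c3 + nn * L + 1 + K0 ^+ 2 + K0 + cI) * M2
    + (K0 * (nn * L) + c2 + nn * L + 1 + K0 ^+ 2 + K0 + cI) * M3
    + (K0 * (nn * L) + c2 + c3 + 1 + K0 ^+ 2 + K0 + cI) * Mtd)
  + Dt * ((K0 * (nn * L) + c2 + c3 + nn * L + 1 + K0 + cI) * M0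
    + (K0 * (nn * L) + c2 + c3 + nn * L + 1 + K0 ^+ 2 + cI) * Mt
    + (K0 * (nn * L) + c2 + c3 + nn * L + 1 + K0 ^+ 2 + K0 + cI) * M2
    + (K0 * (nn * L) + c2 + c3 + nn * L + K0 ^+ 2 + K0 + cI) * Mtt)
  + H * ((K0 * (nn * L) + c2 + c3 + nn * L + 1 + K0 ^+ 2 + K0) * (M1 + M2)).
  by rewrite /X; ring.
have Dt00 := ltW Dt0.
by nonneg.
Qed.

(** The covariance of the cubature turns the quadratic forms into the trace. *)
Lemma mean_drift : \sum_j rho c j * drift j = Fop a phi tn xi.
Proof.
have [_ _ _ rho1 cov] := cub.
rewrite /Fop /drift /quad_part.
set S := sigma P tn xi a; set Q := 2^-1 * \tr _; set g := dotp _ _.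
under eq_bigr do rewrite !mulrDr.
rewrite !big_split /= -!mulr_suml rho1 !mul1r.
have -> : \sum_j rho c j * (2^-1 * \sum_k (S *m Defs.eta c j) k 0 *
    \sum_l (S *m Defs.eta c j) l 0 * Dcl [:: Some l; Some k] (tn, xi)) = Q.
  have SS : S *m S^T = \sum_j rho c j *: ((S *m Defs.eta c j) *m (S *m Defs.eta c j)^T).
    rewrite -{1}[S]mulmx1 -cov mulmx_sumr mulmx_suml; apply: eq_bigr => j _.
    by rewrite -scalemxAr -scalemxAl trmx_mul !mulmxA.
  under eq_bigr do rewrite mulrCA.
  rewrite -mulr_sumr; congr (_ * _); rewrite SS mulmx_suml linear_sum /=.
  apply: eq_bigr => j _; rewrite -scalemxAl linearZ /=; congr (_ * _).
  rewrite /mxtrace; apply: eq_bigr => k _; rewrite [RHS]mxE mulr_sumr; apply: eq_bigr => l _.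
  by rewrite !mxE big_ord1 !mxE mulrA.
have -> : \sum_k mu P tn xi a k 0 * Dcl [:: Some k] (tn, xi) = g.
  by apply: eq_bigr => k _; rewrite !mxE.
rewrite /ptime; ring.
Qed.

Lemma consistency : exists rem,
  Shat c Nt n i a phi - phi (tn, xi) = tau c Nt n i a * Fop a phi tn xi + rem /\
  `|rem| <= branch_constant * tau c Nt n i a * error_bound.
Proof.
have [rem [E1 E2]] := omega_average P c m Nt n i a openO Oi Dt_gt0 cub _ _ _ _ _ (branch_error).
exists rem; rewrite -mean_drift; split; first exact: E1.
by apply: (le_trans E2); rewrite mulrCA mulrA.
Qed.

End Branch.

(** * Suprema and infima *)

Section SupBounds.
Context {R : realType} {N p : nat} (P : problem R N p).
Variable (phi : R * 'cV[R]_N -> R).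
Hypothesis phis : smooth_on_Qcl P phi.
Hypothesis bO : bounded_set (domain P).
Hypothesis T0 : 0 < horizon P.
Local Notation Dcl s := (pderivcl P s phi).

Lemma pderivcl_nil z : Qcl P z -> Dcl [::] z = phi z.
Proof.
move=> Qz; have PF : ProperFilter (within (Qint P) (nbhs z)).
  by apply: within_nbhs_proper; exact: Qcl_closure_Qint.
apply: cvg_lim => //; apply: (phi_cvg P phi phis _ (fun w => w)) => //.
  exact: cvg_within.
exact: withinT.
Qed.

Lemma pderivcl_le_fnorm {m n : nat} (l : 'I_m -> 'I_n -> seq (option 'I_N))
    (A : R * 'cV[R]_N -> 'M[R]_(m, n)) :
  (forall z i j, A z i j = Dcl (l i j) z) ->
  forall z i j, Qcl P z -> `|Dcl (l i j) z| <= supn P (fun z => fnorm (A z)).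
Proof.
move=> AE z i j Qz; rewrite -AE; apply: le_trans (fnorm_coord (A z) i j) _.
have [k kP] := choice (fun ij : 'I_m * 'I_n => pderivcl_bounded P phi phis bO T0 (l ij.1 ij.2)).
apply: (supn_ub P (fun z => fnorm (A z)) (Num.sqrt (\sum_i \sum_j k (i, j) ^+ 2))) => // w Qw.
apply: (fnorm_le (A w) (fun i j => k (i, j))) => i' j'.
by rewrite AE; exact: kP (i', j') _ Qw.
Qed.

Lemma pderivcl_le_sup l z : Qcl P z ->
  `|Dcl l z| <= supn P (fun z => `|Dcl l z|).
Proof.
have [k kP] := pderivcl_bounded P phi phis bO T0 l.
exact: (supn_ub P (fun z => `|Dcl l z|) k).
Qed.

Lemma phi_le_sup z : Qcl P z -> `|phi z| <= supn P (fun z => `|phi z|).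
Proof.
have [k kP] := pderivcl_bounded P phi phis bO T0 [::].
apply: (supn_ub P (fun z => `|phi z|) k) => w Qw.
by rewrite -pderivcl_nil//; exact: kP.
Qed.

Lemma third_le_sup i j k z : Qcl P z ->
  `|Dcl [:: Some i; Some j; Some k] z| <= supn P (third_norm P phi).
Proof.
move=> Qz; apply: (@le_trans _ _ (third_norm P phi z)).
  pose q (a b d : 'I_N) := Dcl [:: Some a; Some b; Some d] z ^+ 2.
  have q0 a b d : 0 <= q a b d by exact: sqr_ge0.
  rewrite -(sqrtr_sqr (Dcl [:: Some i; Some j; Some k] z)); apply: ler_wsqrtr.
  change (q i j k <= \sum_a \sum_b \sum_d q a b d).
  apply: (@le_trans _ _ (\sum_d q i j d)).
    by rewrite (bigD1 k)//= lerDl; apply: sumr_ge0.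
  apply: (@le_trans _ _ (\sum_b \sum_d q i b d)).
    rewrite [leRHS](bigD1 j)//= lerDl; apply: sumr_ge0 => b _; exact: sumr_ge0.
  rewrite [leRHS](bigD1 i)//= lerDl; apply: sumr_ge0 => a _; apply: sumr_ge0 => b _.
  exact: sumr_ge0.
have [B BP] := choice (fun x : 'I_N * 'I_N * 'I_N =>
  pderivcl_bounded P phi phis bO T0 [:: Some x.1.1; Some x.1.2; Some x.2]).
apply: (supn_ub P _ (Num.sqrt (\sum_i \sum_j \sum_k B (i, j, k) ^+ 2))) => // w Qw.
apply: ler_wsqrtr; apply: ler_sum => i' _; apply: ler_sum => j' _; apply: ler_sum => k' _.
rewrite -real_normK ?num_real// lerXn2r ?nnegrE//; last exact: BP (i', j', k') w Qw.
exact: le_trans (BP (i', j', k') w Qw).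
Qed.

End SupBounds.

(** The lower bound matters: the real infimum of a set that is not bounded below
is a default value. *)
Lemma inf_dist {R : realType} {A : Type} (S : set A) (f g : A -> R) (e L : R) :
  S !=set0 -> (forall a, S a -> `|f a - g a| <= e) -> (forall a, S a -> L <= g a) ->
  `|inf [set f a | a in S] - inf [set g a | a in S]| <= e.
Proof.
move=> [a0 Sa0] fg Lg.
have fg1 a : S a -> f a <= g a + e /\ g a <= f a + e.
  by move=> /fg; rewrite ler_norml => /andP[? ?]; split; lra.
have bg : has_lbound [set g a | a in S] by exists L => _ [a Sa <-]; exact: Lg.
have bf : has_lbound [set f a | a in S].
  by exists (L - e) => _ [a Sa <-]; have := Lg a Sa; have := fg1 a Sa; lra.
have h1 : inf [set f a | a in S] - e <= inf [set g a | a in S].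
  apply: lb_le_inf; first by exists (g a0), a0.
  move=> _ [a Sa <-]; have := (fg1 a Sa).1.
  have : inf [set f a | a in S] <= f a by apply: ge_inf => //; exists a.
  lra.
have h2 : inf [set g a | a in S] - e <= inf [set f a | a in S].
  apply: lb_le_inf; first by exists (f a0), a0.
  move=> _ [a Sa <-]; have := (fg1 a Sa).2.
  have : inf [set g a | a in S] <= g a by apply: ge_inf => //; exists a.
  lra.
by rewrite ler_norml; apply/andP; split; lra.
Qed.

Lemma Fop_lower_bound {R : realType} {N p : nat} (P : problem R N p) (K0 : R)
    (phi : R * 'cV[R]_N -> R) t x :
  problem_ok P K0 -> Qcl P (t, x) -> exists L, forall a : ctrl P, L <= Fop a phi t x.
Proof.
move=> Pok Qz.
have K00 : 0 <= K0 by case: Pok => _ _ _ /ltW.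
pose H := hess P phi (t, x); pose G := grad P phi (t, x).
pose b2 := N%:R * (N%:R * (p%:R * (K0 * K0) * fnorm H)).
pose b3 := N%:R * (K0 * fnorm G).
exists (ptime P phi (t, x) - 2^-1 * b2 - b3 - K0 * `|phi (t, x)| - K0) => a.
have [sK mK rK fK] := coef_bounds P K0 Pok (t, x) a Qz.
have h2 : `|\tr (sigma P t x a *m (sigma P t x a)^T *m H)| <= b2.
  apply: norm_sum_le_const => i; rewrite mxE; apply: norm_sum_le_const => k.
  rewrite normrM ler_pM// ?fnorm_coord//.
  rewrite mxE; apply: norm_sum_le_const => l; rewrite mxE normrM.
  by apply: ler_pM => //; exact: le_trans (fnorm_coord _ _ _) sK.
have h3 : `|dotp (mu P t x a) G| <= b3.
  apply: norm_sum_le_const => i; rewrite normrM ler_pM ?fnorm_coord//.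
  exact: le_trans (fnorm_coord _ _ _) mK.
have h4 : `|rate P t x a * phi (t, x)| <= K0 * `|phi (t, x)|.
  by rewrite normrM ler_wpM2r.
rewrite /Fop -/H -/G.
move: h2 h3 h4 fK; rewrite !ler_norml /= => /andP[h2 _] /andP[h3 _] /andP[_ h4] /andP[h5 _].
move: h2 h3 h4 h5; set y2 := \tr _; set y3 := dotp _ _; set y4 := _ * phi _.
set y5 := cost _ _ _ _; set y6 := ptime _ _ _; set y7 := K0 * _.
move=> h2 h3 h4 h5; have : - (2^-1 * b2) <= 2^-1 * y2 by rewrite -mulrN ler_pM2l.
lra.
Qed.

Section Supn.
Context {R : realType} {N p : nat} (P : problem R N p) (c : cubature R p) (m : mesh R N).
Variables (K0 Cbd Cp Cpatch : R).

Definition supn_error (Nt : nat) (phi : R * 'cV[R]_N -> R) : R :=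
  error_bound P m Nt (supn P (fun z => `|phi z|))
    (supn P (fun z => fnorm (grad P phi z)))
    (supn P (fun z => fnorm (hess P phi z)))
    (supn P (third_norm P phi))
    (supn P (fun z => `|ptime P phi z|))
    (supn P (fun z => `|ptime2 P phi z|))
    (supn P (fun z => fnorm (grad_dt P phi z))).

Lemma supn_consistency (Nt n : nat) (i : 'I_(nvert m)) (a : ctrl P) phi :
  problem_ok P K0 -> cubature_ok c ->
  (0 < Nt)%N -> timestep P Nt <= 1 -> mesh_ok P c m Cbd Cp Cpatch Nt ->
  (n < Nt)%N -> domain P (vert m i) -> smooth_on_Qcl P phi ->
  exists rem,
  Shat c Nt n i a phi - phi (tgrid P Nt n, vert m i)
    = tau c Nt n i a * Fop a phi (tgrid P Nt n) (vert m i) + rem /\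
  `|rem| <= branch_constant c K0 Cp Cpatch (N := N) * tau c Nt n i a * supn_error Nt phi.
Proof.
move=> Pok cub Nt0 dt1 mok nNt Oi phis.
have [T0 [_ _ _ bO] _ _ _] := Pok.
apply: (consistency P c m K0 Cbd Cp Cpatch) => //.
- exact: phi_le_sup.
- move=> k z Qz; apply: (pderivcl_le_fnorm P phi phis bO T0
    (fun i (j : 'I_1) => [:: Some i]) (grad P phi) _ z k 0) => //.
  by move=> w i' j'; rewrite mxE.
- move=> k l z Qz; apply: (pderivcl_le_fnorm P phi phis bO T0
    (fun i j => [:: Some i; Some j]) (hess P phi) _ z l k) => //.
  by move=> w i' j'; rewrite mxE.
- by move=> k l o z Qz; exact: third_le_sup.
- exact: pderivcl_le_sup.
- exact: pderivcl_le_sup.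
- move=> k z Qz; apply: (pderivcl_le_fnorm P phi phis bO T0
    (fun i (j : 'I_1) => [:: Some i; None]) (grad_dt P phi) _ z k 0) => //.
  by move=> w i' j'; rewrite mxE.
- by apply: supn_ge0.
- by apply: supn_ge0 => z; exact: fnorm_ge0.
- by apply: supn_ge0 => z; exact: fnorm_ge0.
- by apply: supn_ge0 => z; exact: sqrtr_ge0.
- by apply: supn_ge0.
- by apply: supn_ge0.
- by apply: supn_ge0 => z; exact: fnorm_ge0.
Qed.

End Supn.

Theorem proposition4p3 (R : realType) (N p : nat) (hN : (1 <= N)%N)
    (hp : (1 <= p)%N) (P : problem R N p) (c : cubature R p)
    (K0 Cbd Cp Cpatch : R) (hP : problem_ok P K0) (hc : cubature_ok c) :
  (exists C : R,
    forall (m : mesh R N) (Nt : nat) (phi : R * 'cV[R]_N -> R),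
      (0 < Nt)%N -> timestep P Nt <= 1 -> mesh_ok P c m Cbd Cp Cpatch Nt ->
      smooth_on_Qcl P phi ->
      forall (n : nat) (i : 'I_(nvert m)) (a : ctrl P),
        (n < Nt)%N -> domain P (vert m i) ->
        let D := timestep P Nt in
        let h := mesh_size m in
        let tn := tgrid P Nt n in
        let xi := vert m i in
        let tau_ := tau c Nt n i a in
        exists rem : R,
          Shat c Nt n i a phi - phi (tn, xi) = tau_ * Fop a phi tn xi + rem /\
          `|rem| <= C * tau_ *
            (Num.sqrt D *
               (supn P (fun z => fnorm (grad P phi z))
                + supn P (fun z => fnorm (hess P phi z))
                + supn P (third_norm P phi)
                + supn P (fun z => fnorm (grad_dt P phi z)))
             + D *
               (supn P (fun z => `|phi z|)
                + supn P (fun z => `|ptime P phi z|)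
                + supn P (fun z => fnorm (hess P phi z))
                + supn P (fun z => `|ptime2 P phi z|))
             + h ^+ 2 / D *
               (supn P (fun z => fnorm (grad P phi z))
                + supn P (fun z => fnorm (hess P phi z)))))
  /\
  (forall phi : R * 'cV[R]_N -> R, smooth_on_Qcl P phi ->
    exists Cphi : R,
    forall (m : mesh R N) (Nt : nat),
      (0 < Nt)%N -> timestep P Nt <= 1 -> mesh_ok P c m Cbd Cp Cpatch Nt ->
      forall (n : nat) (i : 'I_(nvert m)),
        (n < Nt)%N -> domain P (vert m i) ->
        let D := timestep P Nt in
        let h := mesh_size m in
        let tn := tgrid P Nt n in
        let xi := vert m i in
        `|inf [set (Shat c Nt n i a phi - phi (tn, xi)) / tau c Nt n i a
              | a in [set: ctrl P]]
          - inf [set Fop a phi tn xi | a in [set: ctrl P]]|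
        <= Cphi * (Num.sqrt D + h ^+ 2 / D)).
Proof.
have [_ [_ openO _ _] [A0 _] _ _] := hP.
pose C := branch_constant c K0 Cp Cpatch (N := N).
split.
  exists C => m Nt phi Nt0 dt1 mok phis n i a nNt Oi D h tn xi tau_.
  exact: (supn_consistency P c m K0 Cbd Cp Cpatch).
move=> phi phis.
pose S1 := supn P (fun z => fnorm (grad P phi z)) + supn P (fun z => fnorm (hess P phi z))
  + supn P (third_norm P phi) + supn P (fun z => fnorm (grad_dt P phi z)).
pose S2 := supn P (fun z => `|phi z|) + supn P (fun z => `|ptime P phi z|)
  + supn P (fun z => fnorm (hess P phi z)) + supn P (fun z => `|ptime2 P phi z|).
pose S3 := supn P (fun z => fnorm (grad P phi z)) + supn P (fun z => fnorm (hess P phi z)).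
have sup0 (g : R * 'cV[R]_N -> R) : (forall z, 0 <= g z) -> 0 <= supn P g.
  exact: supn_ge0.
have S10 : 0 <= S1.
  by rewrite !addr_ge0// sup0// => z; first [exact: fnorm_ge0|exact: sqrtr_ge0].
have S20 : 0 <= S2 by rewrite !addr_ge0// sup0// => z; exact: fnorm_ge0.
have S30 : 0 <= S3 by rewrite addr_ge0// sup0// => z; exact: fnorm_ge0.
exists (`|C| * (S1 + S2 + S3)) => m Nt Nt0 dt1 mok n i nNt Oi.
cbv zeta; set D := timestep P Nt; set h := mesh_size m.
set tn := tgrid P Nt n; set xi := vert m i.
have D0 : 0 < D by exact: (Dt_gt0 P K0).
have s1 : Num.sqrt D <= 1 by rewrite -[leRHS]sqrtr1 ler_wsqrtr.
have DS : D <= Num.sqrt D.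
  by rewrite -{1}(sqr_sqrtr (ltW D0)) expr2 ler_piMl ?sqrtr_ge0.
have H0 : 0 <= h ^+ 2 / D by rewrite divr_ge0 ?sqr_ge0// ltW.
have Q : Qcl P (tn, xi) by exact: (Qcl_node P m K0).
have [L LP] := Fop_lower_bound P K0 phi tn xi hP Q.
apply: inf_dist A0 _ (fun a _ => LP a) => a _.
have [rem [-> remE]] :=
  supn_consistency P c m K0 Cbd Cp Cpatch Nt n i a phi hP hc Nt0 dt1 mok nNt Oi phis.
have tau0 : 0 < tau c Nt n i a by exact: tau_gt0.
rewrite mulrDl mulrAC divff ?gt_eqF// mul1r addrC addKr normrM normfV (gtr0_norm tau0).
rewrite ler_pdivrMr//; apply: (le_trans remE); rewrite -/C mulrAC.
rewrite ler_pM2r// -mulrA.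
apply: (@le_trans _ _ (`|C| * supn_error P m Nt phi)).
  rewrite ler_wpM2r ?ler_norm// /supn_error /error_bound -/S1 -/S2 -/S3.
  by have Dp := ltW D0; have s0 := sqrtr_ge0 D; rewrite -/D -/h; nonneg.
rewrite ler_wpM2l// /supn_error /error_bound -/S1 -/S2 -/S3 -/D -/h -subr_ge0.
set s := Num.sqrt D in DS *; set H := h ^+ 2 / D in H0 *.
rewrite (_ : _ - _ = (s - D) * S2 + s * S3 + H * (S1 + S2)); last by ring.
have e1 : 0 <= s - D by rewrite subr_ge0.
have s0 : 0 <= s by exact: sqrtr_ge0.
by nonneg.
Qed.
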